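(* Let $P,P'\in M_n(\Bbbk)$ be two matrices of Cartan type with the same associated Cartan super-datum $(A,p)$, i.e. with the same symmetric part $P_s=P'_s$. (a) Let $\mathcal{R}$ be a straight realization of $P$ over $\Bbbk$, of rank $t$, and let $\mathfrak{g}_P^{\mathcal{R},p}$ be the associated MpLSbA. Then there exists a matrix $\Theta\in\mathfrak{so}_t(\Bbbk)$ such that $P'=P_\Theta$, the corresponding $\mathcal{R}_\Theta$ is a straight realization of $P'=P_\Theta$, and for the toral twist $j_\Theta$ one has, as Lie superbialgebras, $$\mathfrak{g}_{P'}^{\mathcal{R}_\Theta,p}\ \cong\ \big(\mathfrak{g}_P^{\mathcal{R},p}\big)^{j_\Theta}.$$ (b) Let $\mathcal{R}$ and $\mathcal{R}'$ be straight small realizations of $P$ and $P'$ respectively, with $\mathrm{rk}(\mathcal{R})=\mathrm{rk}(\mathcal{R}')=t$, and let $\mathfrak{g}_P^{\mathcal{R},p}$ and $\mathfrak{g}_{P'}^{\mathcal{R}',p}$ be the associated MpLSbA's. Then there exists $\Theta\in\mathfrak{so}_t(\Bbbk)$ such that $$\mathfrak{g}_{P'}^{\mathcal{R}',p}\ \cong\ \big(\mathfrak{g}_P^{\mathcal{R},p}\big)^{j_\Theta}.$$ (c) Every straight small MpLSbA over $P$ is isomorphic to some toral twist deformation of a Yamane MpLSbA (over $DA=P_s$) of the same rank.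
   Context: $\Bbbk$ is a field of characteristic zero, $I=\{1,\dots,n\}$. Cartan super-data. A Cartan super-datum $(A,p)$ is read off one of the following labelled Dynkin diagrams (vertices are white $\circ$, black $\bullet$ or grey $\otimes$; $\times$ means white or grey; vertices are numbered $1,\dots,n$ from left to right unless indicated): $A_n$: $\times-\times-\cdots-\times$; $B_n(I)$: $\times-\cdots-\times\Rightarrow\circ$; $B_n(II)$: $\times-\cdots-\times\Rightarrow\bullet$; $C_n$: $\times-\cdots-\times\Leftarrow\circ$; $D_n(I)$: a chain of $\times$-vertices $1,\dots,n-2$ with $n-2$ joined to two white vertices $n-1$, $n$; $D_n(II)$: the same with $n-1,n$ grey and joined to each other by a double edge; $F_4$: $\circ_1-\circ_4\Rightarrow\circ_3-\otimes_2$; $G_3$: $\otimes_1-\circ_3\Leftarrow\circ_2$ (triple edge, arrow towards vertex $3$). The parity $p:I\to\mathbb{Z}_2=\{\bar0,\bar1\}$ is $\bar0$ on white and $\bar1$ on black or grey vertices; $A=(a_{ij})\in M_n(\mathbb{Z})$ is the (symmetrizable) Cartan matrix attached to the diagram as follows. In types $A_n,B_n,C_n,D_n$ let $e_1,e_2,\dots$ be orthogonal vectors with $(e_i,e_i)=\varepsilon_i\in\{1,-1\}$, and put $\beta_i=e_i-e_{i+1}$ for $i\le n-1$ and $\beta_n=e_n-e_{n+1}$, $e_n$, $2e_n$, $e_{n-1}+e_n$ in type $A_n$, $B_n$, $C_n$, $D_n$ respectively, where $\varepsilon_{i+1}=\varepsilon_i$ if vertex $i$ is white and $\varepsilon_{i+1}=-\varepsilon_i$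 if it is grey, for all $i$ with $\beta_i=e_i-e_{i+1}$; then $a_{ij}=2(\beta_i,\beta_j)/(\beta_i,\beta_i)$ if vertex $i$ is white or black, and $a_{ij}=\varepsilon_i(\beta_i,\beta_j)$ if it is grey (with $\varepsilon_{n-1}$ in place of $\varepsilon_i$ for $i=n$ in type $D_n(II)$). In type $F_4$ the nonzero entries are $a_{11}=a_{33}=a_{44}=2$, $a_{14}=a_{41}=a_{43}=a_{32}=-1$, $a_{34}=-2$, $a_{23}=1$; in type $G_3$ they are $a_{22}=a_{33}=2$, $a_{13}=1$, $a_{31}=a_{23}=-1$, $a_{32}=-3$. Fix minimal $d_i\in\frac12\mathbb{Z}\setminus\{0\}$ such that $DA$ is symmetric with integral entries, $D=\mathrm{diag}(d_i)$ (in types $A$–$D$, with overall sign such that $DA$ is a positive multiple of $((\beta_i,\beta_j))_{i,j}$). Realizations. $P=(p_{ij})\in M_n(\Bbbk)$ is of Cartan type, with associated Cartan matrix $A$, if $P_s:=\frac12(P+P^T)=DA$. A realization of $P$ over $\Bbbk$ is $\mathcal{R}=(\mathfrak{h},\Pi,\Pi^\vee)$ with $\mathfrak{h}$ a finite-dimensional $\Bbbk$-vector space, $\Pi^\vee=\{T_i^+,T_i^-\}_{i\in I}\subseteq\mathfrak{h}$, $\Pi=\{\alpha_i\}_{i\in I}\subseteq\mathfrak{h}^*$, such that $\alpha_j(T_i^+)=p_{ij}$, $\alpha_j(T_i^-)=p_{ji}$, and the $S_i:=\frac12(T_i^++T_i^-)$ are linearly independent. Its rank is $\mathrm{rk}(\mathcal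 R)=\dim\mathfrak h$. It is straight if the $\alpha_i$ are linearly independent, and small if $\mathrm{Span}\{S_i\}=\mathrm{Span}\{T_i^\pm\}$. The Lie superalgebra $\mathfrak{g}^{\mathcal{R},p}_P$ is generated over $\Bbbk$ by the vector space $\mathfrak{h}$ (even) and elements $E_i,F_i$ ($i\in I$) of parity $p(i)$, with relations (for $T,T'\in\mathfrak h$, $i,j,\ell\in I$): $[T,T']=0$; $[T,E_j]=\alpha_j(T)E_j$; $[T,F_j]=-\alpha_j(T)F_j$; $[E_i,F_\ell]=\delta_{i\ell}\frac{T_i^++T_i^-}{2d_i}$; $[E_i,E_j]=0=[F_i,F_j]$ if $a_{ij}=0$; $(\mathrm{ad}\,E_i)^{1-a_{ij}}(E_j)=0=(\mathrm{ad}\,F_i)^{1-a_{ij}}(F_j)$ if $i\neq j$, $p(i)=\bar0$; and, for $X\in\{E,F\}$: (1) $[[[X_i,X_j],X_k],X_j]=0$ whenever $i,j,k$ form a subdiagram $\times_i-\otimes_j-\times_k$, or $\times_i-\otimes_j\Rightarrow\bullet_k$, or $\times_i-\otimes_j\Rightarrow\times_k$; (2) $[[[X_{n-1},X_n],X_n],X_n]=0$ in type $B_n$ with $\times_{n-1}\Rightarrow\bullet_n$; (3) $[[X_{n-2},X_{n-1}],X_n]=[[X_{n-2},X_n],X_{n-1}]$ in type $D_n(II)$; (4) $[[[[X_{n-2},X_{n-1}],X_n],[X_{n-2},X_{n-1}]],X_{n-1}]=0$ in type $C_n$ with $\otimes_{n-2}-\otimes_{n-1}\Leftarrow\circ_n$;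 (5) $[[[[[[X_{n-3},X_{n-2}],X_{n-1}],X_n],X_{n-1}],X_{n-2}],X_{n-1}]=0$ in type $C_n$ with $\times_{n-3}-\otimes_{n-2}-\otimes_{n-1}\Leftarrow\circ_n$. With $x\wedge y:=\frac12(x\otimes y-(-1)^{|x||y|}y\otimes x)$, it is a Lie superbialgebra, called a multiparameter Lie superbialgebra (MpLSbA) of rank $\dim\mathfrak h$, with Lie cobracket $\delta(T)=0$, $\delta(E_i)=2T_i^+\wedge E_i$, $\delta(F_i)=2T_i^-\wedge F_i$. It is called straight (small) if $\mathcal R$ is. A Yamane MpLSbA is one of the form $\mathfrak g^{\mathcal R_A,p}_{DA}$ with $\mathcal R_A$ a straight realization of $DA$. Twist deformations. Fix a basis $\{H_g\}_{g=1,\dots,t}$ of $\mathfrak h$. For $\Theta=(\theta_{gk})\in\mathfrak{so}_t(\Bbbk)$ (antisymmetric) the toral twist is $j_\Theta:=\sum_{g,k}\theta_{gk}H_g\otimes H_k$. The deformation $\mathfrak g^{j_\Theta}$ of $\mathfrak g=\mathfrak g^{\mathcal R,p}_P$ has the same superbracket and the new cobracket $\delta^{j_\Theta}(x):=\delta(x)-x.j_\Theta$ (adjoint action on $\mathfrak g\otimes\mathfrak g$). With $\mathfrak A:=(\alpha_i(H_g))_{i\in I,\,g}$ set $P_\Theta:=P-\mathfrak A\,\Theta\,\mathfrak A^T$, $T^\pm_{\Theta,i}:=T_i^\pm\pm\sum_{g,k}\alpha_i(H_g)\theta_{kg}H_k$, and $\mathcal R_\Theta:=(\mathfrak h,\Pi,\{T^\pm_{\Theta,i}\}_{i\in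 I})$, a realization of $P_\Theta$. *)

(* Defs.v *)
From HB Require Import structures.
From mathcomp Require Import all_boot all_order all_algebra.
From mathcomp Require Import boolp.

Set Implicit Arguments.
Unset Strict Implicit.
Unset Printing Implicit Defensive.

Import Order.TTheory GRing.Theory Num.Theory.
Local Open Scope ring_scope.
Local Open Scope quotient_scope.

(* A type of formal expressions with a congruence modulo which the axioms of
   k-vector spaces hold. *)
Record precongr (k : fieldType) := Precongr {
  pc_expr :> Type;
  pc0 : pc_expr;
  pcD : pc_expr -> pc_expr -> pc_expr;
  pcZ : k -> pc_expr -> pc_expr;
  pcR : pc_expr -> pc_expr -> Prop;
  pc_refl : forall x, pcR x x;
  pc_sym : forall x y, pcR x y -> pcR y x;
  pc_trans : forall x y z, pcR x y -> pcR y z -> pcR x z;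
  pc_congD : forall x x' y y', pcR x x' -> pcR y y' -> pcR (pcD x y) (pcD x' y');
  pc_congZ : forall a x x', pcR x x' -> pcR (pcZ a x) (pcZ a x');
  pc_addA : forall x y z, pcR (pcD x (pcD y z)) (pcD (pcD x y) z);
  pc_addC : forall x y, pcR (pcD x y) (pcD y x);
  pc_add0 : forall x, pcR (pcD pc0 x) x;
  pc_addN : forall x, pcR (pcD (pcZ (- 1) x) x) pc0;
  pc_scaleA : forall a b x, pcR (pcZ a (pcZ b x)) (pcZ (a * b) x);
  pc_scale1 : forall x, pcR (pcZ 1 x) x;
  pc_scaleDr : forall a x y, pcR (pcZ a (pcD x y)) (pcD (pcZ a x) (pcZ a y));
  pc_scaleDl : forall a b x, pcR (pcZ (a + b) x) (pcD (pcZ a x) (pcZ b x)) }.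

Section Quotient.
Variables (k : fieldType) (C : precongr k).

Definition pc_rel : rel {classic C} := fun x y => `[< @pcR k C x y >].

Lemma pc_rel_refl : reflexive pc_rel.
Proof. by move=> x; apply/asboolP/pc_refl. Qed.
Lemma pc_rel_sym : symmetric pc_rel.
Proof. by move=> x y; apply/asboolP/asboolP; apply: pc_sym. Qed.
Lemma pc_rel_trans : transitive pc_rel.
Proof. by move=> y x z /asboolP xy /asboolP yz; apply/asboolP/(pc_trans xy). Qed.

Canonical pc_equiv := EquivRel pc_rel pc_rel_refl pc_rel_sym pc_rel_trans.

Definition quot : Type := {eq_quot pc_equiv}.
HB.instance Definition _ := Choice.on quot.

Definition cls (x : C) : quot := \pi_{eq_quot pc_equiv} (x : {classic C}).
Definition rep (q : quot) : C := repr (q : {eq_quot pc_equiv}).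

Lemma repK q : cls (rep q) = q. Proof. exact: reprK. Qed.

Lemma clsP x y : cls x = cls y <-> @pcR k C x y.
Proof.
split; first by move=> /eqmodP /asboolP.
by move=> xy; apply/eqmodP/asboolP.
Qed.

Lemma rep_cls x : @pcR k C (rep (cls x)) x.
Proof. by apply/clsP; rewrite repK. Qed.

Definition quot_add (p q : quot) : quot := cls (pcD (rep p) (rep q)).
Definition quot_scale (a : k) (q : quot) : quot := cls (pcZ a (rep q)).
Definition quot_opp (q : quot) : quot := quot_scale (- 1) q.

Lemma quot_addE x y : quot_add (cls x) (cls y) = cls (pcD x y).
Proof. by apply/clsP/pc_congD; apply: rep_cls. Qed.
Lemma quot_scaleE a x : quot_scale a (cls x) = cls (pcZ a x).
Proof. by apply/clsP/pc_congZ/rep_cls. Qed.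

Lemma quot_addA : associative quot_add.
Proof.
move=> p q r; rewrite -[p]repK -[q]repK -[r]repK !quot_addE.
exact/clsP/pc_addA.
Qed.
Lemma quot_addC : commutative quot_add.
Proof. by move=> p q; rewrite -[p]repK -[q]repK !quot_addE; exact/clsP/pc_addC. Qed.
Lemma quot_add0 : left_id (cls (pc0 C)) quot_add.
Proof. by move=> p; rewrite -[p]repK !quot_addE; exact/clsP/pc_add0. Qed.
Lemma quot_addN : left_inverse (cls (pc0 C)) quot_opp quot_add.
Proof.
by move=> p; rewrite -[p]repK /quot_opp quot_scaleE quot_addE; exact/clsP/pc_addN.
Qed.

HB.instance Definition _ :=
  GRing.isZmodule.Build quot quot_addA quot_addC quot_add0 quot_addN.

Lemma cls0 : cls (pc0 C) = 0. Proof. by []. Qed.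
Lemma clsD x y : cls (pcD x y) = cls x + cls y.
Proof. by rewrite -quot_addE. Qed.

Lemma quot_scaleA a b q : quot_scale a (quot_scale b q) = quot_scale (a * b) q.
Proof. by rewrite -[q]repK !quot_scaleE; exact/clsP/pc_scaleA. Qed.
Lemma quot_scale1 : left_id 1 quot_scale.
Proof. by move=> q; rewrite -[q]repK !quot_scaleE; exact/clsP/pc_scale1. Qed.
Lemma quot_scaleDr : right_distributive quot_scale +%R.
Proof.
move=> a p q; rewrite -[p]repK -[q]repK -clsD !quot_scaleE -clsD.
exact/clsP/pc_scaleDr.
Qed.
Lemma quot_scaleDl q : {morph quot_scale^~ q : a b / a + b}.
Proof.
by move=> a b; rewrite -[q]repK !quot_scaleE -clsD; exact/clsP/pc_scaleDl.
Qed.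

HB.instance Definition _ := GRing.Zmodule_isLmodule.Build k quot
  quot_scaleA quot_scale1 quot_scaleDr quot_scaleDl.

Lemma clsZ a x : cls (pcZ a x) = a *: cls x.
Proof. by rewrite -quot_scaleE. Qed.

End Quotient.

Definition bilin (k : fieldType) (V W U : lmodType k) (B : V -> W -> U) : Prop :=
  (forall w, linear (B^~ w)) /\ (forall v, linear (B v)).

Section Tensor.
Variables (k : fieldType) (V W : lmodType k).

Inductive texpr : Type :=
| TZero
| TAdd of texpr & texpr
| TScale of k & texpr
| TPure of V & W.

Inductive trel : texpr -> texpr -> Prop :=
| trel_refl x : trel x x
| trel_sym x y : trel x y -> trel y x
| trel_trans x y z : trel x y -> trel y z -> trel x z
| trel_congD x x' y y' : trel x x' -> trel y y' -> trel (TAdd x y) (TAdd x' y')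
| trel_congZ a x x' : trel x x' -> trel (TScale a x) (TScale a x')
| trel_addA x y z : trel (TAdd x (TAdd y z)) (TAdd (TAdd x y) z)
| trel_addC x y : trel (TAdd x y) (TAdd y x)
| trel_add0 x : trel (TAdd TZero x) x
| trel_addN x : trel (TAdd (TScale (- 1) x) x) TZero
| trel_scaleA a b x : trel (TScale a (TScale b x)) (TScale (a * b) x)
| trel_scale1 x : trel (TScale 1 x) x
| trel_scaleDr a x y : trel (TScale a (TAdd x y)) (TAdd (TScale a x) (TScale a y))
| trel_scaleDl a b x : trel (TScale (a + b) x) (TAdd (TScale a x) (TScale b x))
| trel_linl a v v' w :
    trel (TPure (a *: v + v') w) (TAdd (TScale a (TPure v w)) (TPure v' w))
| trel_linr a v w w' :
    trel (TPure v (a *: w + w')) (TAdd (TScale a (TPure v w)) (TPure v w')).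

Definition tens_precongr : precongr k :=
  Precongr trel_refl trel_sym trel_trans trel_congD trel_congZ trel_addA
    trel_addC trel_add0 trel_addN trel_scaleA trel_scale1 trel_scaleDr
    trel_scaleDl.

Definition tens : lmodType k := quot tens_precongr.

Definition tpure (v : V) (w : W) : tens := @cls k tens_precongr (TPure v w).

Lemma tpure_bilin : bilin tpure.
Proof.
split=> [w|v] a u u'; rewrite /tpure.
  rewrite -(@clsZ k tens_precongr) -(@clsD k tens_precongr).
  by apply/(@clsP k tens_precongr)/trel_linl.
rewrite -(@clsZ k tens_precongr) -(@clsD k tens_precongr).
by apply/(@clsP k tens_precongr)/trel_linr.
Qed.

Section Lift.
Variables (U : lmodType k) (B : V -> W -> U).

Fixpoint teval (e : texpr) : U :=
  match e with
  | TZero => 0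
  | TAdd x y => teval x + teval y
  | TScale a x => a *: teval x
  | TPure v w => B v w
  end.

(* For bilinear B this is the linear map V (x) W -> U induced by B. *)
Definition tlift (t : tens) : U := teval (@rep k tens_precongr t).

Hypothesis hB : bilin B.

Lemma teval_rel x y : trel x y -> teval x = teval y.
Proof.
case: hB => hl hr.
elim=> //= {x y}.
- by move=> x y z _ -> _ ->.
- by move=> x x' y y' _ -> _ ->.
- by move=> a x x' _ ->.
- by move=> x y z; rewrite addrA.
- by move=> x y; rewrite addrC.
- by move=> x; rewrite add0r.
- by move=> x; rewrite scaleN1r addNr.
- by move=> a b x; rewrite scalerA.
- by move=> x; rewrite scale1r.
- by move=> a x y; rewrite scalerDr.
- by move=> a b x; rewrite scalerDl.
- by move=> a v v' w; apply: hl.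
- by move=> a v w w'; apply: hr.
Qed.

Lemma tlift_cls (e : texpr) : tlift (@cls k tens_precongr e) = teval e.
Proof. exact/teval_rel/(@rep_cls k tens_precongr). Qed.

Lemma tlift_pure v w : tlift (tpure v w) = B v w.
Proof. exact: tlift_cls. Qed.

Lemma tlift_linear : linear tlift.
Proof.
move=> a s t; rewrite -[s](@repK k tens_precongr) -[t](@repK k tens_precongr).
rewrite -(@clsZ k tens_precongr) -(@clsD k tens_precongr).
by rewrite !tlift_cls.
Qed.

End Lift.
End Tensor.

Notation "V ⊗ W" := (tens V W) (at level 40, left associativity) : type_scope.
Notation "x ⊗ y" := (tpure x y) (at level 40, left associativity) : ring_scope.

Definition tmap (k : fieldType) (V W V' W' : lmodType k) (f : V -> V')
    (g : W -> W') : (V ⊗ W)%type -> (V' ⊗ W')%type :=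
  tlift (fun x y => f x ⊗ g y).

(* The parity of homogeneous elements is a boolean, true meaning odd. *)
Definition sgn (k : fieldType) (a b : bool) : k := (- 1) ^+ (a && b).

(* The Z_2-grading is given by the projectors lsP b onto its components. *)
Record lieSuperalgebra (k : fieldType) := LieSuperalgebra {
  ls_car :> lmodType k;
  lsP : bool -> ls_car -> ls_car;
  lsB : ls_car -> ls_car -> ls_car;
  lsP_linear : forall b, linear (lsP b);
  lsP_idem : forall a b x, lsP a (lsP b x) = if a == b then lsP b x else 0;
  lsP_sum : forall x, x = lsP false x + lsP true x;
  lsB_bilin : bilin lsB;
  lsB_graded : forall a b x y, lsP a x = x -> lsP b y = y ->
    lsP (a (+) b) (lsB x y) = lsB x y;
  lsB_anti : forall a b x y, lsP a x = x -> lsP b y = y ->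
    lsB x y = - (sgn k a b *: lsB y x);
  lsB_jacobi : forall a b x y z, lsP a x = x -> lsP b y = y ->
    lsB x (lsB y z) = lsB (lsB x y) z + sgn k a b *: lsB y (lsB x z) }.

Section Presented.
Variables (k : fieldType) (G : Type) (par : G -> bool).

Inductive lexpr : Type :=
| LZero
| LAdd of lexpr & lexpr
| LScale of k & lexpr
| LGen of G
| LBr of lexpr & lexpr.

(* lpr b e represents the component of parity b of e. *)
Fixpoint lpr (b : bool) (e : lexpr) : lexpr :=
  match e with
  | LZero => LZero
  | LAdd x y => LAdd (lpr b x) (lpr b y)
  | LScale a x => LScale a (lpr b x)
  | LGen g => if par g == b then LGen g else LZero
  | LBr x y => LAdd (LBr (lpr false x) (lpr b y)) (LBr (lpr true x) (lpr (~~ b) y))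
  end.

Variable relator : lexpr -> Prop.

(* Relators are imposed through their homogeneous components; those used below
   are all homogeneous. *)
Inductive lrel : lexpr -> lexpr -> Prop :=
| lrel_refl x : lrel x x
| lrel_sym x y : lrel x y -> lrel y x
| lrel_trans x y z : lrel x y -> lrel y z -> lrel x z
| lrel_congD x x' y y' : lrel x x' -> lrel y y' -> lrel (LAdd x y) (LAdd x' y')
| lrel_congZ a x x' : lrel x x' -> lrel (LScale a x) (LScale a x')
| lrel_congB x x' y y' : lrel x x' -> lrel y y' -> lrel (LBr x y) (LBr x' y')
| lrel_addA x y z : lrel (LAdd x (LAdd y z)) (LAdd (LAdd x y) z)
| lrel_addC x y : lrel (LAdd x y) (LAdd y x)
| lrel_add0 x : lrel (LAdd LZero x) x
| lrel_addN x : lrel (LAdd (LScale (- 1) x) x) LZero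
| lrel_scaleA a b x : lrel (LScale a (LScale b x)) (LScale (a * b) x)
| lrel_scale1 x : lrel (LScale 1 x) x
| lrel_scaleDr a x y : lrel (LScale a (LAdd x y)) (LAdd (LScale a x) (LScale a y))
| lrel_scaleDl a b x : lrel (LScale (a + b) x) (LAdd (LScale a x) (LScale b x))
| lrel_linl a x x' y :
    lrel (LBr (LAdd (LScale a x) x') y) (LAdd (LScale a (LBr x y)) (LBr x' y))
| lrel_linr a x y y' :
    lrel (LBr x (LAdd (LScale a y) y')) (LAdd (LScale a (LBr x y)) (LBr x y'))
| lrel_anti a b x y :
    lrel (LBr (lpr a x) (lpr b y))
         (LScale (- 1) (LScale (sgn k a b) (LBr (lpr b y) (lpr a x))))
| lrel_jacobi a b x y z :
    lrel (LBr (lpr a x) (LBr (lpr b y) z))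
         (LAdd (LBr (LBr (lpr a x) (lpr b y)) z)
               (LScale (sgn k a b) (LBr (lpr b y) (LBr (lpr a x) z))))
| lrel_relator b r : relator r -> lrel (lpr b r) LZero.

Definition lie_precongr : precongr k :=
  Precongr lrel_refl lrel_sym lrel_trans lrel_congD lrel_congZ lrel_addA
    lrel_addC lrel_add0 lrel_addN lrel_scaleA lrel_scale1 lrel_scaleDr
    lrel_scaleDl.

Let Q : lmodType k := quot lie_precongr.
Let cl (x : lexpr) : Q := @cls k lie_precongr x.
Let rp (q : Q) : lexpr := @rep k lie_precongr q.

Let clP x y : cl x = cl y <-> lrel x y. Proof. exact: clsP. Qed.
Let rpK q : cl (rp q) = q. Proof. exact: repK. Qed.
Let rp_cl x : lrel (rp (cl x)) x. Proof. exact: (@rep_cls k lie_precongr). Qed.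
Let clD x y : cl (LAdd x y) = cl x + cl y. Proof. exact: (@clsD k lie_precongr). Qed.
Let clZ a x : cl (LScale a x) = a *: cl x. Proof. exact: (@clsZ k lie_precongr). Qed.
Let cl0 : cl LZero = 0. Proof. by []. Qed.

Definition pres_br (p q : Q) : Q := cl (LBr (rp p) (rp q)).

Let clB x y : cl (LBr x y) = pres_br (cl x) (cl y).
Proof. by apply/clP/lrel_congB; apply/lrel_sym/rp_cl. Qed.

Lemma pres_br_bilin : bilin pres_br.
Proof.
split=> [y|x] a u v.
  rewrite -[y]rpK -[u]rpK -[v]rpK /= -clZ -clD -!clB -clZ -clD.
  exact/clP/lrel_linl.
rewrite -[x]rpK -[u]rpK -[v]rpK /= -clZ -clD -!clB -clZ -clD.
exact/clP/lrel_linr.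
Qed.

Let brDl x x' y : pres_br (x + x') y = pres_br x y + pres_br x' y.
Proof. by have := pres_br_bilin.1 y 1 x x'; rewrite /= !scale1r. Qed.
Let brDr x y y' : pres_br x (y + y') = pres_br x y + pres_br x y'.
Proof. by have := pres_br_bilin.2 x 1 y y'; rewrite /= !scale1r. Qed.
Let br0l y : pres_br 0 y = 0.
Proof. by apply: (addrI (pres_br 0 y)); rewrite -brDl !addr0. Qed.
Let br0r y : pres_br y 0 = 0.
Proof. by apply: (addrI (pres_br y 0)); rewrite -brDr !addr0. Qed.
Let brZl a x y : pres_br (a *: x) y = a *: pres_br x y.
Proof. by have := pres_br_bilin.1 y a x 0; rewrite /= !addr0 br0l addr0. Qed.
Let brZr a x y : pres_br x (a *: y) = a *: pres_br x y.
Proof. by have := pres_br_bilin.2 x a y 0; rewrite /= !addr0 br0r addr0. Qed.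

Let clE := (clD, clZ, clB, cl0).
Let brE := (brDl, brDr, br0l, br0r, brZl, brZr).

Let lpr_idem a b x : cl (lpr a (lpr b x)) = if a == b then cl (lpr b x) else 0.
Proof.
elim: x a b => [|x hx y hy|c x hx|g|x hx y hy] a b /=.
- by case: ifP.
- by rewrite !clE hx hy; case: ifP => // _; rewrite addr0.
- by rewrite !clE hx; case: ifP => // _; rewrite scaler0.
- case: (par g =P b) => [<-|] /=; last by case: ifP.
  by rewrite eq_sym; case: ifP.
- by rewrite !clE !hx !hy; case: a b => [] [] /=; rewrite !brE ?addr0 ?add0r.
Qed.

Let lpr_sum x : cl x = cl (lpr false x) + cl (lpr true x).
Proof.
elim: x => [|x hx y hy|c x hx|g|x hx y hy] /=.
- by rewrite cl0 addr0.
- by rewrite !clE hx hy addrACA.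
- by rewrite !clE hx scalerDr.
- by case: (par g); rewrite /= ?cl0 ?add0r ?addr0.
- rewrite !clE {1}hx {1}hy !brE -!addrA; congr (_ + _).
  by rewrite addrA addrC.
Qed.

Let lpr_rel b x y : lrel x y -> cl (lpr b x) = cl (lpr b y).
Proof.
move=> xy; elim: xy b => {x y} /=.
- by [].
- by move=> x y _ h b; rewrite h.
- by move=> x y z _ h _ h' b; rewrite h h'.
- by move=> x x' y y' _ h _ h' b; rewrite !clE h h'.
- by move=> a x x' _ h b; rewrite !clE h.
- by move=> x x' y y' _ h _ h' b; rewrite !clE !h !h'.
- by move=> x y z b; rewrite !clE addrA.
- by move=> x y b; rewrite !clE addrC.
- by move=> x b; rewrite !clE add0r.
- by move=> x b; rewrite !clE scaleN1r addNr.
- by move=> a c x b; rewrite !clE scalerA.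
- by move=> x b; rewrite !clE scale1r.
- by move=> a x y b; rewrite !clE scalerDr.
- by move=> a c x b; rewrite !clE scalerDl.
- by move=> a x x' y b; rewrite !clE !brE scalerDr addrACA.
- by move=> a x y y' b; rewrite !clE !brE scalerDr addrACA.
- move=> a b x y c; rewrite !clE !lpr_idem.
  have := lrel_anti a b x y => /clP; rewrite !clE.
  case: a b c => [] [] [] /= E; rewrite !brE ?addr0 ?add0r ?scaler0 //.
- move=> a b x y z c; rewrite !clE !lpr_idem.
  have E d : pres_br (cl (lpr a x)) (pres_br (cl (lpr b y)) (cl (lpr d z))) =
     pres_br (pres_br (cl (lpr a x)) (cl (lpr b y))) (cl (lpr d z)) +
     sgn k a b *: pres_br (cl (lpr b y)) (pres_br (cl (lpr a x)) (cl (lpr d z))).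
    by have := lrel_jacobi a b x y (lpr d z) => /clP; rewrite !clE.
  have := E c; have := E (~~ c).
  by case: a b c {E} => [] [] [] /= E E';
    rewrite !brE ?addr0 ?add0r ?scaler0 ?addr0 ?add0r ?E ?E'.
- move=> a r hr b; rewrite lpr_idem cl0.
  by have /clP := lrel_relator a hr; rewrite cl0 => ->; case: ifP.
Qed.

Definition pres_pr (b : bool) (q : Q) : Q := cl (lpr b (rp q)).

Let prE b x : pres_pr b (cl x) = cl (lpr b x).
Proof. exact/lpr_rel/rp_cl. Qed.

Let pr_linear b : linear (pres_pr b).
Proof.
by move=> a x y; rewrite -[x]rpK -[y]rpK -clZ -clD !prE /= !clE.
Qed.

Let pr_idem a b x : pres_pr a (pres_pr b x) = if a == b then pres_pr b x else 0.
Proof. by rewrite -[x]rpK !prE lpr_idem. Qed.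

Let pr_sum x : x = pres_pr false x + pres_pr true x.
Proof. by rewrite -[x]rpK !prE -lpr_sum. Qed.

Let br_graded a b x y : pres_pr a x = x -> pres_pr b y = y ->
  pres_pr (a (+) b) (pres_br x y) = pres_br x y.
Proof.
rewrite -[x]rpK -[y]rpK (prE a) (prE b) => <- <-.
rewrite -!clB prE /= !clE !lpr_idem.
by case: a b => [] [] /=; rewrite !brE ?addr0 ?add0r.
Qed.

Let br_anti a b x y : pres_pr a x = x -> pres_pr b y = y ->
  pres_br x y = - (sgn k a b *: pres_br y x).
Proof.
rewrite -[x]rpK -[y]rpK (prE a) (prE b) => <- <-; rewrite -!clB.
have /clP -> := lrel_anti a b (rp x) (rp y).
by rewrite !clE scaleN1r.
Qed.

Let br_jacobi a b x y z : pres_pr a x = x -> pres_pr b y = y ->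
  pres_br x (pres_br y z) =
  pres_br (pres_br x y) z + sgn k a b *: pres_br y (pres_br x z).
Proof.
rewrite -[x]rpK -[y]rpK -[z]rpK (prE a) (prE b) => <- <-; rewrite -!clB.
by have /clP -> := lrel_jacobi a b (rp x) (rp y) (rp z); rewrite !clE.
Qed.

Definition presented : lieSuperalgebra k :=
  LieSuperalgebra pr_linear pr_idem pr_sum pres_br_bilin br_graded br_anti
    br_jacobi.

Definition pcls (e : lexpr) : presented := @cls k lie_precongr e.

Lemma pclsD x y : pcls (LAdd x y) = pcls x + pcls y. Proof. exact: clD. Qed.
Lemma pclsZ a x : pcls (LScale a x) = a *: pcls x. Proof. exact: clZ. Qed.
Lemma pclsB x y : pcls (LBr x y) = lsB (pcls x) (pcls y).
Proof. exact: clB. Qed.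
Lemma pclsP b x : lsP b (pcls x) = pcls (lpr b x). Proof. exact: prE. Qed.

Lemma pcls_surj (q : presented) : exists e, q = pcls e.
Proof. by exists (rp q); rewrite /pcls -[q in LHS]rpK. Qed.

Lemma pcls_relator r : relator r -> pcls r = 0.
Proof.
move=> hr; rewrite /pcls [LHS]lpr_sum.
have h b : cl (lpr b r) = cl LZero by apply/clP/lrel_relator.
by rewrite !h cl0 addr0.
Qed.

End Presented.

Section SignedTensorMaps.
Variables (k : fieldType) (g : lieSuperalgebra k).
Local Notation sg := (sgn k).

Definition tens_pr (c : bool) : (g ⊗ g)%type -> (g ⊗ g)%type :=
  tlift (fun x y => \sum_(a : bool) (lsP a x ⊗ lsP (a (+) c) y)).

Definition tens_flip : (g ⊗ g)%type -> (g ⊗ g)%type :=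
  tlift (fun x y =>
    \sum_(a : bool) \sum_(b : bool) sg a b *: (lsP b y ⊗ lsP a x)).

(* The cyclic permutation (x ⊗ y) ⊗ z |-> (-1)^(|x|(|y|+|z|)) (y ⊗ z) ⊗ x. *)
Definition tens_cyc : (g ⊗ g ⊗ g)%type -> (g ⊗ g ⊗ g)%type :=
  tlift (fun t z => tlift (fun x y =>
    \sum_(a : bool) \sum_(b : bool) \sum_(c : bool)
      sg a (b (+) c) *: (lsP b y ⊗ lsP c z ⊗ lsP a x)) t).

Definition tens_ad (x : g) : (g ⊗ g)%type -> (g ⊗ g)%type :=
  tlift (fun y z => lsB x y ⊗ z +
    \sum_(a : bool) \sum_(b : bool) sg a b *: (lsP b y ⊗ lsB (lsP a x) z)).

Definition wedge (x y : g) : (g ⊗ g)%type :=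
  2^-1 *: (x ⊗ y - tens_flip (x ⊗ y)).

End SignedTensorMaps.

Record cobracketed (k : fieldType) := Cobracketed {
  cb_alg :> lieSuperalgebra k;
  cb_delta : cb_alg -> (cb_alg ⊗ cb_alg)%type }.

Record is_lieSuperbialgebra (k : fieldType) (g : cobracketed k) : Prop := {
  delta_linear : linear (@cb_delta k g);
  delta_even : forall b (x : g), cb_delta (lsP b x) = tens_pr b (cb_delta x);
  delta_anti : forall x : g, tens_flip (cb_delta x) = - cb_delta x;
  delta_cojacobi : forall x : g,
    let t := tmap (@cb_delta k g) id (cb_delta x) in
    t + tens_cyc t + tens_cyc (tens_cyc t) = 0;
  delta_cocycle : forall a b (x y : g), lsP a x = x -> lsP b y = y ->
    cb_delta (lsB x y) =
    tens_ad x (cb_delta y) - sgn k a b *: tens_ad y (cb_delta x) }.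

Definition lieSuperbialgebra_iso (k : fieldType) (g g' : cobracketed k) : Prop :=
  exists phi : g -> g',
    [/\ linear phi, bijective phi,
        forall b x, phi (lsP b x) = lsP b (phi x),
        forall x y, phi (lsB x y) = lsB (phi x) (phi y) &
        forall x, cb_delta (phi x) = tmap phi phi (cb_delta x)].

Notation "g ≅ g'" := (lieSuperbialgebra_iso g g') (at level 70) : type_scope.

Definition twist_deformation (k : fieldType) (g : cobracketed k)
    (j : (g ⊗ g)%type) : cobracketed k :=
  Cobracketed (fun x : g => cb_delta x - tens_ad x j).

Inductive color := White | Black | Grey.
Definition is_white c := if c is White then true else false.
Definition is_black c := if c is Black then true else false.
Definition is_grey c := if c is Grey then true else false.

Inductive dynkin_type := TyA | TyB1 | TyB2 | TyC | TyD1 | TyD2 | TyF4 | TyG3.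

Definition is_typeD ty := match ty with TyD1 | TyD2 => true | _ => false end.
Definition is_classical ty := match ty with TyF4 | TyG3 => false | _ => true end.

(* The vertices 1, ..., n are represented by 'I_n. *)
Definition vtx (n : nat) (i : 'I_n) : nat := i.+1.

Definition diagram_wf (n : nat) (ty : dynkin_type) (col : 'I_n -> color) : Prop :=
  match ty with
  | TyA => (0 < n)%N /\ forall i, ~~ is_black (col i)
  | TyB1 => (0 < n)%N /\ forall i,
      if vtx i == n then is_white (col i) else ~~ is_black (col i)
  | TyB2 => (0 < n)%N /\ forall i,
      if vtx i == n then is_black (col i) else ~~ is_black (col i)
  | TyC => (1 < n)%N /\ forall i,
      if vtx i == n then is_white (col i) else ~~ is_black (col i)
  | TyD1 => (2 < n)%N /\ forall i,
      if (n.-1 <= vtx i)%N then is_white (col i) else ~~ is_black (col i)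
  | TyD2 => (2 < n)%N /\ forall i,
      if (n.-1 <= vtx i)%N then is_grey (col i) else ~~ is_black (col i)
  | TyF4 => n = 4%N /\ forall i, col i = if vtx i == 2%N then Grey else White
  | TyG3 => n = 3%N /\ forall i, col i = if vtx i == 1%N then Grey else White
  end.

(* dg_neg tells whether epsilon_1 = -1; it has no influence on the Cartan
   matrix, only on the overall sign of the symmetrizer. *)
Record diagram (n : nat) := Diagram {
  dg_type : dynkin_type;
  dg_color : 'I_n -> color;
  dg_neg : bool;
  dg_wf : diagram_wf dg_type dg_color }.

Section CartanData.
Variables (n : nat) (D : diagram n).
Local Notation ty := (dg_type D).
Local Notation col := (dg_color D).

Definition parity (i : 'I_n) : bool := ~~ is_white (col i).

Definition eps (l : nat) : int :=
  (- 1) ^+ (dg_neg D + #|[set i : 'I_n | (vtx i < l)%N && is_grey (col i)]|).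

(* Vectors are represented by their coordinates on e_1, ..., e_(n+1). *)
Definition evec (l : nat) : nat -> int := fun m => (m == l)%:R.

Definition beta (i : 'I_n) : nat -> int := fun m =>
  if (vtx i < n)%N then evec (vtx i) m - evec (vtx i).+1 m else
  match ty with
  | TyB1 | TyB2 => evec n m
  | TyC => 2 * evec n m
  | TyD1 | TyD2 => evec n.-1 m + evec n m
  | _ => evec n m - evec n.+1 m
  end.

Definition eform (x y : nat -> int) : int :=
  \sum_(1 <= l < n.+2) eps l * x l * y l.

Definition F4_cartan : seq (seq int) :=
  [:: [::  2;  0;  0; -1];
      [::  0;  0;  1;  0];
      [::  0; -1;  2; -2];
      [:: -1;  0; -1;  2]].

Definition G3_cartan : seq (seq int) :=
  [:: [::  0;  0;  1];
      [::  0;  2; -1];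
      [:: -1; -3;  2]].

(* The quotients below are exact. *)
Definition cartan : 'M[int]_n := \matrix_(i, j)
  match ty with
  | TyF4 => nth 0 (nth [::] F4_cartan i) j
  | TyG3 => nth 0 (nth [::] G3_cartan i) j
  | _ =>
    if is_grey (col i) then
      (if is_typeD ty && (vtx i == n) then eps n.-1 else eps (vtx i)) *
      eform (beta i) (beta j)
    else ((2 * eform (beta i) (beta j)) %/ eform (beta i) (beta i))%Z
  end.

Definition integral_symmetrizer (d : 'I_n -> rat) : Prop :=
  [/\ forall i, d i != 0, forall i, 2 * d i \is a Num.int,
      forall i j, d i * (cartan i j)%:~R = d j * (cartan j i)%:~R &
      forall i j, d i * (cartan i j)%:~R \is a Num.int].

Definition symmetrizer (d : 'I_n -> rat) : Prop :=
  [/\ integral_symmetrizer d,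
      forall d', integral_symmetrizer d' -> forall i, `|d i| <= `|d' i| &
      is_classical ty -> exists2 c : rat, 0 < c &
        forall i j, d i * (cartan i j)%:~R = c * (eform (beta i) (beta j))%:~R].

Definition DAmx (k : fieldType) (d : 'I_n -> rat) : 'M[k]_n :=
  \matrix_(i, j) ratr (d i * (cartan i j)%:~R).

Definition cartan_type (k : fieldType) (d : 'I_n -> rat) (P : 'M[k]_n) : Prop :=
  2^-1 *: (P + P^T) = DAmx k d.

Definition consecutive (i j : 'I_n) : bool := (i.+1 == j) || (j.+1 == i).

Definition last_two (i j : 'I_n) : bool :=
  [&& (n.-1 <= vtx i)%N, (n.-1 <= vtx j)%N & i != j].

Definition single_edge (i j : 'I_n) : bool :=
  match ty with
  | TyA => consecutive i j
  | TyB1 | TyB2 | TyC => consecutive i j && ~~ last_two i j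
  | TyD1 | TyD2 => (consecutive i j && ~~ last_two i j) ||
      ((vtx i, vtx j) \in [:: (n.-2, n); (n, n.-2)])
  | TyF4 => (vtx i, vtx j) \in [:: (1, 4); (4, 1); (3, 2); (2, 3)]%N
  | TyG3 => (vtx i, vtx j) \in [:: (1, 3); (3, 1)]%N
  end.

(* The arrow points to the second argument. *)
Definition double_arrow (i j : 'I_n) : bool :=
  match ty with
  | TyB1 | TyB2 => (vtx i == n.-1) && (vtx j == n)
  | TyC => (vtx i == n) && (vtx j == n.-1)
  | TyF4 => (vtx i, vtx j) == (4, 3)%N
  | _ => false
  end.

(* The last condition discards the fork formed in type D by the vertices
   n-1, n-2, n: that subdiagram is of type D_3, not a chain of type A_3. For
   D_n(I) with n-2 grey the bracket in question has weight 2e_(n-2), which is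
   a root, and must not be killed. *)
Definition grey_chain (i j l : 'I_n) : bool :=
  [&& i != l, ~~ is_black (col i), is_grey (col j), single_edge i j,
      (single_edge j l && ~~ is_black (col l)) || double_arrow j l &
      ~~ (is_typeD ty && last_two i l)].

End CartanData.

Record realization (k : fieldType) (n : nat) := Realization {
  re_h : vectType k;
  re_Tp : 'I_n -> re_h;
  re_Tm : 'I_n -> re_h;
  re_alpha : 'I_n -> 'Hom(re_h, k^o) }.

Section Realizations.
Variables (k : fieldType) (n : nat) (R : realization k n).

Definition re_S (i : 'I_n) : re_h R := 2^-1 *: (re_Tp R i + re_Tm R i).

Definition realizes (P : 'M[k]_n) : Prop :=
  [/\ forall i j, re_alpha R j (re_Tp R i) = P i j,
      forall i j, re_alpha R j (re_Tm R i) = P j i &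
      free [seq re_S i | i <- enum 'I_n]].

Definition rank : nat := \dim {: re_h R}.

Definition straight : Prop := free [seq re_alpha R i | i <- enum 'I_n].

Definition small : Prop :=
  (<<[seq re_S i | i <- enum 'I_n]>> =
   <<[seq re_Tp R i | i <- enum 'I_n] ++ [seq re_Tm R i | i <- enum 'I_n]>>)%VS.

End Realizations.

Section MpLSbA.
Variables (k : fieldType) (n : nat) (D : diagram n) (d : 'I_n -> rat).
Variable R : realization k n.
Local Notation a := (cartan D).
Local Notation ty := (dg_type D).
Local Notation col := (dg_color D).

Inductive mpgen : Type := GH of re_h R | GE of 'I_n | GF of 'I_n.

Definition mppar (x : mpgen) : bool :=
  match x with GH _ => false | GE i | GF i => parity D i end.

Local Notation lexpr := (lexpr k mpgen).
(* The relator expressing the relation x = y. *)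
Local Notation "x ≐ y" := (LAdd x (LScale (- 1) y)) (at level 70).
Local Notation "[ x , y ]" := (LBr x y).
Local Notation "0" := (LZero k mpgen).
Local Notation H := (fun T => LGen k (GH T)).
Local Notation E := (fun i => LGen k (GE i)).
Local Notation F := (fun i => LGen k (GF i)).

Definition mpX (s : bool) (i : 'I_n) : lexpr := if s then E i else F i.

Inductive mp_relator : lexpr -> Prop :=
| mp_lin c T T' : mp_relator (H (c *: T + T') ≐ LAdd (LScale c (H T)) (H T'))
| mp_HH T T' : mp_relator ([H T, H T'] ≐ 0)
| mp_HE T j : mp_relator ([H T, E j] ≐ LScale (re_alpha R j T : k) (E j))
| mp_HF T j : mp_relator ([H T, F j] ≐ LScale (- (re_alpha R j T : k)) (F j))
| mp_EF i : mp_relator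
    ([E i, F i] ≐ LScale (2 * ratr (d i))^-1 (H (re_Tp R i + re_Tm R i)))
| mp_EF0 i l : i != l -> mp_relator ([E i, F l] ≐ 0)
| mp_comm s i j : a i j = 0%R -> mp_relator ([mpX s i, mpX s j] ≐ 0)
| mp_serre s i j : i != j -> parity D i = false ->
    (* 1 - a i j is positive here *)
    mp_relator (iter `|1 - a i j|%N (fun x => [mpX s i, x]) (mpX s j) ≐ 0)
| mp_rel1 s i j l : let X := mpX s in
    grey_chain D i j l ->
    mp_relator ([[[X i, X j], X l], X j] ≐ 0)
| mp_rel2 s i j : let X := mpX s in
    ty = TyB2 -> vtx i = n.-1 -> vtx j = n ->
    mp_relator ([[[X i, X j], X j], X j] ≐ 0)
| mp_rel3 s i j l : let X := mpX s in
    ty = TyD2 -> vtx i = n.-2 -> vtx j = n.-1 -> vtx l = n ->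
    mp_relator ([[X i, X j], X l] ≐ [[X i, X l], X j])
| mp_rel4 s i j l : let X := mpX s in
    ty = TyC -> vtx i = n.-2 -> vtx j = n.-1 -> vtx l = n ->
    is_grey (col i) -> is_grey (col j) ->
    mp_relator ([[[[X i, X j], X l], [X i, X j]], X j] ≐ 0)
| mp_rel5 s h i j l : let X := mpX s in
    ty = TyC -> vtx h = n.-1.-2 -> vtx i = n.-2 -> vtx j = n.-1 -> vtx l = n ->
    is_grey (col i) -> is_grey (col j) ->
    mp_relator ([[[[[[X h, X i], X j], X l], X j], X i], X j] ≐ 0).

Definition mp_alg : lieSuperalgebra k := presented mppar mp_relator.

Definition mpH (T : re_h R) : mp_alg := pcls mppar mp_relator (H T).
Definition mpE (i : 'I_n) : mp_alg := pcls mppar mp_relator (E i).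
Definition mpF (i : 'I_n) : mp_alg := pcls mppar mp_relator (F i).

(* Lie superbialgebra structures on mp_alg with the prescribed cobracket; there
   is at most one, see mplsba_unique. *)
Record mplsba := Mplsba {
  mp_delta : mp_alg -> (mp_alg ⊗ mp_alg)%type;
  mp_lsb : is_lieSuperbialgebra (Cobracketed mp_delta);
  mp_deltaH : forall T, mp_delta (mpH T) = 0%R;
  mp_deltaE : forall i, mp_delta (mpE i) = 2 *: wedge (mpH (re_Tp R i)) (mpE i);
  mp_deltaF : forall i, mp_delta (mpF i) = 2 *: wedge (mpH (re_Tm R i)) (mpF i) }.

Definition mp_cobracketed (g : mplsba) : cobracketed k :=
  Cobracketed (mp_delta g).

End MpLSbA.

Coercion mp_cobracketed : mplsba >-> cobracketed.

Section ToralTwist.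
Variables (k : fieldType) (n t : nat) (R : realization k n).
Variables (H : t.-tuple (re_h R)) (Theta : 'M[k]_t).

Definition rootmx : 'M[k]_(n, t) := \matrix_(i, g) re_alpha R i (tnth H g).

Definition twist_mx (P : 'M[k]_n) : 'M[k]_n :=
  P - rootmx *m Theta *m rootmx^T.

Definition twist_vec (i : 'I_n) : re_h R :=
  \sum_(g < t) \sum_(l < t) (re_alpha R i (tnth H g) * Theta l g) *: tnth H l.

Definition twist_realization : realization k n :=
  Realization (fun i => re_Tp R i + twist_vec i)
              (fun i => re_Tm R i - twist_vec i) (re_alpha R).

Definition toral_twist (D : diagram n) (d : 'I_n -> rat) :
    (mp_alg D d R ⊗ mp_alg D d R)%type :=
  \sum_(g < t) \sum_(l < t)
    Theta g l *: (mpH D d (tnth H g) ⊗ mpH D d (tnth H l)).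

Definition toral_deformation (D : diagram n) (d : 'I_n -> rat)
    (g : mplsba D d R) : cobracketed k :=
  @twist_deformation k g (toral_twist D d).

End ToralTwist.

Section LinearFunctions.
Variables (k : fieldType) (U V : lmodType k) (f : U -> V).
Hypothesis fl : linear f.

Lemma linfD x y : f (x + y) = f x + f y.
Proof. by have := fl 1 x y; rewrite !scale1r. Qed.
Lemma linf0 : f 0 = 0.
Proof. by apply: (addrI (f 0)); rewrite -linfD !addr0. Qed.
Lemma linfZ c x : f (c *: x) = c *: f x.
Proof. by have := fl c x 0; rewrite linf0 !addr0. Qed.

End LinearFunctions.

Lemma mplsba_unique (k : fieldType) (n : nat) (D : diagram n) (d : 'I_n -> rat)
  (R : realization k n) (g g' : mplsba D d R) : mp_delta g =1 mp_delta g'.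
Proof.
move=> q; have [e ->] := pcls_surj q.
have hl : linear (mp_delta g) := delta_linear (mp_lsb g).
have hl' : linear (mp_delta g') := delta_linear (mp_lsb g').
have hev b (x : mp_alg D d R) : mp_delta g (lsP b x) = tens_pr b (mp_delta g x).
  exact: (delta_even (mp_lsb g)).
have hev' b (x : mp_alg D d R) : mp_delta g' (lsP b x) = tens_pr b (mp_delta g' x).
  exact: (delta_even (mp_lsb g')).
have hc b c (x y : mp_alg D d R) : lsP b x = x -> lsP c y = y ->
    mp_delta g (lsB x y) =
    tens_ad x (mp_delta g y) - sgn k b c *: tens_ad y (mp_delta g x).
  exact: (delta_cocycle (mp_lsb g)).
have hc' b c (x y : mp_alg D d R) : lsP b x = x -> lsP c y = y ->
    mp_delta g' (lsB x y) =
    tens_ad x (mp_delta g' y) - sgn k b c *: tens_ad y (mp_delta g' x).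
  exact: (delta_cocycle (mp_lsb g')).
elim: e => [|x hx y hy|c x hx|[T|i|i]|x hx y hy].
- by rewrite [LHS](linf0 hl) [RHS](linf0 hl').
- by rewrite pclsD (linfD hl) (linfD hl') hx hy.
- by rewrite pclsZ (linfZ hl) (linfZ hl') hx.
- by rewrite [LHS]mp_deltaH [RHS]mp_deltaH.
- by rewrite [LHS]mp_deltaE [RHS]mp_deltaE.
- by rewrite [LHS]mp_deltaF [RHS]mp_deltaF.
rewrite pclsB; move: (pcls _ _ x) (pcls _ _ y) hx hy => {}x {}y hx hy.
have pp b (z : mp_alg D d R) : lsP b (lsP b z) = lsP b z.
  by rewrite lsP_idem eqxx.
have main b c : mp_delta g (lsB (lsP b x) (lsP c y)) =
    mp_delta g' (lsB (lsP b x) (lsP c y)).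
  by rewrite (hc b c) ?pp // (hc' b c) ?pp // !hev !hev' hx hy.
have [brl brr] := lsB_bilin (mp_alg D d R).
rewrite (lsP_sum x) (lsP_sum y) (linfD (brl _)).
rewrite !(linfD (brr _)).
by rewrite !(linfD hl) !(linfD hl') !main.
Qed.

(* Main.v *)
Require Import Defs.
From HB Require Import structures.
From mathcomp Require Import all_boot all_order all_algebra.
From mathcomp Require Import ring.
From mathcomp Require boolp.

Set Implicit Arguments.
Unset Strict Implicit.
Unset Printing Implicit Defensive.

Import GRing.Theory.
Local Open Scope ring_scope.

(** The defining relations of the Lie superalgebra attached to a realization
involve the coroots only through the sums T_i^+ + T_i^-. A toral twist moves
T_i^+ and T_i^- by opposite vectors, so it does not touch the Lie superalgebra
and changes only the cobracket; the question is which pairs (T_i^+, T_i^-) with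
a prescribed sum it can reach. Write A for the matrix (alpha_i(H_g)). The twist
by Theta adds to T_i^+ the vector with coordinates row i of - A Theta, and
straightness says that A has independent rows. For such an A, the matrices
A Theta with Theta antisymmetric are exactly the M for which M A^T is
antisymmetric ([antisymmetric_factor]). Hence every family of vectors v_i
with alpha_j(v_i) = - alpha_i(v_j) is a family of twisting vectors
([twist_vec_prescribed]). Two realizations on the same space with the same
roots and the same S_i differ by such a family as soon as their matrices have the
same symmetric part, so each is a toral twist of the other
([prescribed_toral_twist]).

This settles the combinatorial side. In (a) the family is chosen so that the
twisted realization has matrix P'. In (b) the two realizations live on different
spaces, and one first identifies them: a vector space with n independent
vectors S_i and n independent forms alpha_j is determined up to isomorphism by
its dimension and the matrix (alpha_j(S_i)) ([realization_unique]), which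
here is the common symmetric part. In (c) the Yamane realization replaces both
T_i^+ and T_i^- by S_i; it exists as a Lie superbialgebra because it is itself a
toral twist of the given one, and the given one is a twist of it in turn.

On the bialgebra side two facts are needed. First, the deformed cobracket is
again a Lie superbialgebra structure ([toral_twist_lieSuperbialgebra]). Only
the co-Jacobi identity takes work: x.j is a sum of terms
H_l (x) D_l x - D_l x (x) H_l for commuting even derivations
D_l, and after expanding, the correction terms cancel in pairs under cyclic
permutation. Second, the deformed cobracket takes on the generators E_i, F_i the
values prescribed by the twisted coroots, so that it can be carried
to the algebra of the new realization ([mplsba_toral_deformation]); the cobracket
there being determined by its values on generators, it is the expected one
([mplsba_iso_toral_deformation]). *)

(** * Bilinear maps and tensor products *)

Section Bilinear.
Variables (k : fieldType) (V W U : lmodType k) (B : V -> W -> U).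
Hypothesis hB : bilin B.

Lemma bilDl x x' y : B (x + x') y = B x y + B x' y.
Proof. exact: (linfD (hB.1 y)). Qed.
Lemma bilDr x y y' : B x (y + y') = B x y + B x y'.
Proof. exact: (linfD (hB.2 x)). Qed.
Lemma bil0l y : B 0 y = 0.
Proof. exact: (linf0 (hB.1 y)). Qed.
Lemma bil0r x : B x 0 = 0.
Proof. exact: (linf0 (hB.2 x)). Qed.
Lemma bilZl c x y : B (c *: x) y = c *: B x y.
Proof. exact: (linfZ (hB.1 y)). Qed.
Lemma bilZr c x y : B x (c *: y) = c *: B x y.
Proof. exact: (linfZ (hB.2 x)). Qed.
Lemma bilNl x y : B (- x) y = - B x y.
Proof. by rewrite -scaleN1r bilZl scaleN1r. Qed.
Lemma bilNr x y : B x (- y) = - B x y.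
Proof. by rewrite -scaleN1r bilZr scaleN1r. Qed.
Lemma bil_suml (I : finType) (F : I -> V) y :
  B (\sum_i F i) y = \sum_i B (F i) y.
Proof. by apply: (big_morph (B^~ y)) => [u v|]; rewrite ?bilDl ?bil0l. Qed.
Lemma bil_sumr (I : finType) (F : I -> W) x :
  B x (\sum_i F i) = \sum_i B x (F i).
Proof. by apply: (big_morph (B x)) => [u v|]; rewrite ?bilDr ?bil0r. Qed.

End Bilinear.

Section PureTensors.
Variables (k : fieldType) (V W : lmodType k).
Local Notation tb := (@tpure_bilin k V W).

Definition tpureDl := bilDl tb.
Definition tpureDr := bilDr tb.
Definition tpure0l := bil0l tb.
Definition tpure0r := bil0r tb.
Definition tpureZl := bilZl tb.
Definition tpureZr := bilZr tb.
Definition tpureNl := bilNl tb.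
Definition tpureNr := bilNr tb.
Definition tpure_suml := bil_suml tb.
Definition tpure_sumr := bil_sumr tb.

(** Scalars are absorbed in the first factor, so identities between additive
maps need to be checked on pure tensors only. *)
Lemma tens_ind (Q : (V ⊗ W)%type -> Prop) :
  (forall s t, Q s -> Q t -> Q (s + t)) -> (forall x y, Q (x ⊗ y)) ->
  forall t, Q t.
Proof.
move=> hD hp t; rewrite -[t](@repK k (tens_precongr V W)).
suff h e c : Q (c *: @cls k (tens_precongr V W) e).
  by rewrite -[cls _]scale1r.
elim: e c => [|x hx y hy|a x hx|x y] c.
- by rewrite (cls0 (tens_precongr V W)) scaler0 -(tpure0l 0).
- by rewrite (@clsD k (tens_precongr V W)) scalerDr; apply: hD.
- by rewrite (@clsZ k (tens_precongr V W)) scalerA.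
- by rewrite -/(tpure x y) -tpureZl.
Qed.

End PureTensors.

Section LinearSums.
Variables (k : fieldType) (V W : lmodType k) (f : V -> W).
Hypothesis lf : linear f.

Lemma linfN x : f (- x) = - f x.
Proof. by rewrite -scaleN1r (linfZ lf) scaleN1r. Qed.
Lemma linfB x y : f (x - y) = f x - f y.
Proof. by rewrite (linfD lf) linfN. Qed.
Lemma linf_sum (I : finType) (F : I -> V) : f (\sum_i F i) = \sum_i f (F i).
Proof. by apply: (big_morph f) => [u v|]; rewrite ?(linfD lf) ?(linf0 lf). Qed.

End LinearSums.

Section BilinearMaps.
Variables (k : fieldType) (V W U : lmodType k).

Lemma bilin_sum (I : finType) (B : I -> V -> W -> U) :
  (forall i, bilin (B i)) -> bilin (fun x y => \sum_i B i x y).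
Proof.
move=> hB; split=> [w|v] c x y /=; rewrite scaler_sumr -big_split /=;
  apply: eq_bigr => i _; first by rewrite ((hB i).1 w).
by rewrite ((hB i).2 v).
Qed.

Lemma bilin_scale c (B : V -> W -> U) :
  bilin B -> bilin (fun x y => c *: B x y).
Proof.
move=> hB; split=> [w|v] a x y /=; first by rewrite (hB.1 w) scalerDr !scalerA mulrC.
by rewrite (hB.2 v) scalerDr !scalerA mulrC.
Qed.

Lemma bilin_add (B C : V -> W -> U) :
  bilin B -> bilin C -> bilin (fun x y => B x y + C x y).
Proof.
move=> hB hC; split=> [w|v] a x y /=.
  by rewrite (hB.1 w) (hC.1 w) scalerDr addrACA.
by rewrite (hB.2 v) (hC.2 v) scalerDr addrACA.
Qed.

Lemma bilin_comp (V' W' : lmodType k) (B : V' -> W' -> U) (f : V -> V') (g : W -> W') :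
  bilin B -> linear f -> linear g -> bilin (fun x y => B (f x) (g y)).
Proof.
move=> hB lf lg; split=> [w|v] a x y /=; first by rewrite lf (hB.1 (g w)).
by rewrite lg (hB.2 (f v)).
Qed.

Lemma bilin_swap (B : W -> V -> U) : bilin B -> bilin (fun x y => B y x).
Proof. by case=> h h'; split. Qed.

End BilinearMaps.

Section TensorMaps.
Variables (k : fieldType).

Lemma tmap_bilin (V W V' W' : lmodType k) (f : V -> V') (g : W -> W') :
  linear f -> linear g -> bilin (fun x y => f x ⊗ g y).
Proof. exact: bilin_comp (tpure_bilin _ _). Qed.

Lemma tmap_pure (V W V' W' : lmodType k) (f : V -> V') (g : W -> W') x y :
  linear f -> linear g -> tmap f g (x ⊗ y) = f x ⊗ g y.
Proof. by move=> lf lg; apply/tlift_pure/tmap_bilin. Qed.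

Lemma tmap_linear (V W V' W' : lmodType k) (f : V -> V') (g : W -> W') :
  linear f -> linear g -> linear (tmap f g).
Proof. by move=> lf lg; apply/tlift_linear/tmap_bilin. Qed.

Lemma id_linear (V : lmodType k) : linear (@id V).
Proof. by []. Qed.

Lemma comp_linear (V W U : lmodType k) (f : W -> U) (g : V -> W) :
  linear f -> linear g -> linear (fun x => f (g x)).
Proof. by move=> lf lg c x y; rewrite lg lf. Qed.

End TensorMaps.

(** * Signed maps on the tensor square of a Lie superalgebra *)

Section Homogeneous.
Variables (k : fieldType) (g : lieSuperalgebra k).
Implicit Types (x y z h : g) (a b c : bool).
Local Notation sg := (sgn k).

HB.instance Definition _ b :=
  GRing.isLinear.Build k g g _ (@lsP k g b) (lsP_linear b).

Lemma lsB_linear x : linear (@lsB k g x).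
Proof. exact: (lsB_bilin g).2. Qed.
HB.instance Definition _ x :=
  GRing.isLinear.Build k g g _ (@lsB k g x) (lsB_linear x).

Definition lsBDl := bilDl (lsB_bilin g).
Definition lsB0l := bil0l (lsB_bilin g).
Definition lsBZl := bilZl (lsB_bilin g).
Definition lsB_suml := bil_suml (lsB_bilin g).
Definition lsBDr := bilDr (lsB_bilin g).
Definition lsBZr := bilZr (lsB_bilin g).
Definition lsB_sumr := bil_sumr (lsB_bilin g).

Lemma lsPP b x : lsP b (lsP b x) = lsP b x.
Proof. by rewrite lsP_idem eqxx. Qed.

Lemma lsP_hom a b x : lsP a x = x -> lsP b x = if b == a then x else 0.
Proof. by move=> <-; rewrite lsP_idem. Qed.

(** With its two companions below, this reduces an additive identity to
homogeneous arguments, on which each signed map is a single term with an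
explicit sign. *)
Lemma parity_ind (Q : g -> Prop) :
  (forall x y, Q x -> Q y -> Q (x + y)) ->
  (forall a x, lsP a x = x -> Q x) -> forall x, Q x.
Proof.
by move=> hD hh x; rewrite [x]lsP_sum; apply: hD; apply: hh (lsPP _ _).
Qed.

Lemma tens_parity_ind (Q : (g ⊗ g)%type -> Prop) :
  (forall s t, Q s -> Q t -> Q (s + t)) ->
  (forall a b x y, lsP a x = x -> lsP b y = y -> Q (x ⊗ y)) ->
  forall t, Q t.
Proof.
move=> hD hp; apply: tens_ind => // x y.
elim/parity_ind: x => [x x' hx hx'|a x hx]; first by rewrite tpureDl; apply: hD.
elim/parity_ind: y => [y y' hy hy'|b y hy]; first by rewrite tpureDr; apply: hD.
exact: hp hx hy.
Qed.

Lemma tens3_parity_ind (Q : (g ⊗ g ⊗ g)%type -> Prop) :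
  (forall s t, Q s -> Q t -> Q (s + t)) ->
  (forall a b c x y z, lsP a x = x -> lsP b y = y -> lsP c z = z ->
     Q (x ⊗ y ⊗ z)) ->
  forall t, Q t.
Proof.
move=> hD hp; apply: tens_ind => // t z.
elim/tens_parity_ind: t => [s t hs ht|a b x y hx hy]; first by rewrite tpureDl; apply: hD.
elim/parity_ind: z => [z z' hz hz'|c z hz]; first by rewrite tpureDr; apply: hD.
exact: hp hx hy hz.
Qed.

Lemma lsB_evenl h x : lsP false h = h -> lsB x h = - lsB h x.
Proof.
move=> hh; elim/parity_ind: x => [x y hx hy|a x hx].
  by rewrite lsBDl raddfD hx hy opprD.
by rewrite (lsB_anti hx hh) /sgn andbF scale1r.
Qed.

Lemma tens_pr_bilin c :
  bilin (fun x y => \sum_(a : bool) (lsP a x ⊗ lsP (a (+) c) y)).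
Proof. by apply: bilin_sum => a; apply: tmap_bilin; apply: lsP_linear. Qed.

Lemma tens_pr_linear c : linear (@tens_pr k g c).
Proof. exact: tlift_linear (tens_pr_bilin c). Qed.
HB.instance Definition _ c :=
  GRing.isLinear.Build k _ _ _ (@tens_pr k g c) (tens_pr_linear c).

Lemma tens_pr_hom c a b x y : lsP a x = x -> lsP b y = y ->
  tens_pr c (x ⊗ y) = if c == a (+) b then x ⊗ y else 0.
Proof.
move=> hx hy; rewrite /tens_pr (tlift_pure (tens_pr_bilin c)) big_bool /=.
rewrite !(lsP_hom _ hx) !(lsP_hom _ hy).
by case: a b c {hx hy} => [] [] [] /=; rewrite ?tpure0l ?tpure0r ?addr0 ?add0r.
Qed.

Lemma tens_flip_bilin : bilin (fun x y : g =>
  \sum_(a : bool) \sum_(b : bool) sg a b *: (lsP b y ⊗ lsP a x)).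
Proof.
apply: bilin_sum => a; apply: bilin_sum => b; apply: bilin_scale.
by apply: (bilin_swap (B := fun y x => lsP b y ⊗ lsP a x));
   apply: tmap_bilin; apply: lsP_linear.
Qed.

Lemma tens_flip_linear : linear (@tens_flip k g).
Proof. exact: tlift_linear tens_flip_bilin. Qed.
HB.instance Definition _ :=
  GRing.isLinear.Build k _ _ _ (@tens_flip k g) tens_flip_linear.

Lemma tens_flip_hom a b x y : lsP a x = x -> lsP b y = y ->
  tens_flip (x ⊗ y) = sg a b *: (y ⊗ x).
Proof.
move=> hx hy; rewrite /tens_flip (tlift_pure tens_flip_bilin) !big_bool /=.
rewrite !(lsP_hom _ hx) !(lsP_hom _ hy).
by case: a b {hx hy} => [] [] /=;
  rewrite ?tpure0l ?tpure0r ?scaler0 ?addr0 ?add0r.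
Qed.

Lemma tens_cyc_bilin z : bilin (fun x y : g =>
    \sum_(a : bool) \sum_(b : bool) \sum_(c : bool)
      sg a (b (+) c) *: (lsP b y ⊗ lsP c z ⊗ lsP a x)).
Proof.
apply: bilin_sum => a; apply: bilin_sum => b; apply: bilin_sum => c.
apply: bilin_scale.
apply: (bilin_swap (B := fun y x => lsP b y ⊗ lsP c z ⊗ lsP a x)).
apply: (tmap_bilin (f := fun y => lsP b y ⊗ lsP c z)); last exact: lsP_linear.
by move=> r y y'; rewrite linearP tpureDl tpureZl.
Qed.

Lemma tens_cyc_bilin2 : bilin (fun (t : g ⊗ g) (z : g) => tlift (fun x y =>
    \sum_(a : bool) \sum_(b : bool) \sum_(c : bool)
      sg a (b (+) c) *: (lsP b y ⊗ lsP c z ⊗ lsP a x)) t).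
Proof.
split=> [z|t]; first exact: tlift_linear (tens_cyc_bilin z).
move=> r z z'; elim/tens_ind: t => [s t|x y].
  rewrite !(linfD (tlift_linear (tens_cyc_bilin _))) => -> ->.
  by rewrite addrACA -scalerDr.
rewrite !(tlift_pure (tens_cyc_bilin _)).
do 3![rewrite scaler_sumr -big_split /=; apply: eq_bigr => ? _].
by rewrite linearP tpureDr tpureDl scalerDr tpureZr tpureZl !scalerA mulrC.
Qed.

Lemma tens_cyc_linear : linear (@tens_cyc k g).
Proof. exact: tlift_linear tens_cyc_bilin2. Qed.
HB.instance Definition _ :=
  GRing.isLinear.Build k _ _ _ (@tens_cyc k g) tens_cyc_linear.

Lemma tens_cyc_hom a b c x y z : lsP a x = x -> lsP b y = y -> lsP c z = z ->
  tens_cyc (x ⊗ y ⊗ z) = sg a (b (+) c) *: (y ⊗ z ⊗ x).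
Proof.
move=> hx hy hz; rewrite /tens_cyc (tlift_pure tens_cyc_bilin2).
rewrite (tlift_pure (tens_cyc_bilin z)) !big_bool /=.
rewrite !(lsP_hom _ hx) !(lsP_hom _ hy) !(lsP_hom _ hz).
by case: a b c {hx hy hz} => [] [] [] /=;
  rewrite ?(tpure0l, tpure0r, scaler0, addr0, add0r).
Qed.

Lemma tens_ad_bilin x : bilin (fun y z => lsB x y ⊗ z +
    \sum_(a : bool) \sum_(b : bool) sg a b *: (lsP b y ⊗ lsB (lsP a x) z)).
Proof.
apply: bilin_add; first exact: (tmap_bilin (lsB_linear x) (@id_linear k g)).
apply: bilin_sum => a; apply: bilin_sum => b; apply: bilin_scale.
exact: tmap_bilin (lsP_linear b) (lsB_linear _).
Qed.

Lemma tens_ad_linear x : linear (@tens_ad k g x).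
Proof. exact: tlift_linear (tens_ad_bilin x). Qed.
HB.instance Definition _ x :=
  GRing.isLinear.Build k _ _ _ (@tens_ad k g x) (tens_ad_linear x).

Lemma tens_ad_hom a b x y z : lsP a x = x -> lsP b y = y ->
  tens_ad x (y ⊗ z) = lsB x y ⊗ z + sg a b *: (y ⊗ lsB x z).
Proof.
move=> hx hy; rewrite /tens_ad (tlift_pure (tens_ad_bilin x)) !big_bool /=.
rewrite !(lsP_hom _ hx) !(lsP_hom _ hy).
by case: a b {hx hy} => [] [] /=;
  rewrite ?(tpure0l, tpure0r, lsB0l, scaler0, addr0, add0r).
Qed.

Lemma tens_ad_linearl t : linear (fun x => tens_ad x t).
Proof.
move=> c x y; elim/tens_ind: t => [s t|u v].
  by rewrite !raddfD /= => -> ->; rewrite addrACA -scalerDr.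
rewrite /tens_ad !(tlift_pure (tens_ad_bilin _)) lsBDl lsBZl tpureDl tpureZl.
rewrite scalerDr addrACA; congr (_ + _).
do 2![rewrite scaler_sumr -big_split /=; apply: eq_bigr => ? _].
by rewrite linearP /= lsBDl lsBZl tpureDr scalerDr tpureZr !scalerA mulrC.
Qed.

Implicit Type t : (g ⊗ g)%type.
Implicit Type u : (g ⊗ g ⊗ g)%type.

Lemma sgnV a b : sg a b * sg a b = 1.
Proof. by rewrite /sgn -signr_addb addbb. Qed.

Lemma sgnC a b : sg a b = sg b a.
Proof. by rewrite /sgn andbC. Qed.

Lemma sgn0r b : sg b false = 1. Proof. by rewrite sgnC. Qed.

Lemma sgnD a b c : sg a (b (+) c) = sg a b * sg a c.
Proof. by rewrite /sgn -signr_addb; case: a. Qed.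

Lemma tens_flip_even h x : lsP false h = h -> tens_flip (h ⊗ x) = x ⊗ h.
Proof.
move=> hh; elim/parity_ind: x => [x y hx hy|a x hx].
  by rewrite tpureDr raddfD /= hx hy tpureDl.
by rewrite (tens_flip_hom hh hx) scale1r.
Qed.

Lemma tens_flip_evenr h x : lsP false h = h -> tens_flip (x ⊗ h) = h ⊗ x.
Proof.
move=> hh; elim/parity_ind: x => [x y hx hy|a x hx].
  by rewrite tpureDl raddfD /= hx hy tpureDr.
by rewrite (tens_flip_hom hx hh) sgn0r scale1r.
Qed.

Lemma tens_cyc_even h y z : lsP false h = h ->
  tens_cyc (h ⊗ y ⊗ z) = y ⊗ z ⊗ h.
Proof.
move=> hh; elim/parity_ind: y => [y y' hy hy'|b y hy].
  by rewrite tpureDr !tpureDl raddfD /= hy hy'.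
elim/parity_ind: z => [z z' hz hz'|c z hz].
  by rewrite !tpureDr tpureDl raddfD /= hz hz'.
by rewrite (tens_cyc_hom hh hy hz) scale1r.
Qed.

Lemma tens_cyc3 u : tens_cyc (tens_cyc (tens_cyc u)) = u.
Proof.
elim/tens3_parity_ind: u => [s t hs ht|a b c x y z hx hy hz].
  by rewrite !raddfD /= hs ht.
rewrite (tens_cyc_hom hx hy hz) !linearZ /= (tens_cyc_hom hy hz hx).
rewrite !linearZ /= (tens_cyc_hom hz hx hy) !scalerA !sgnD.
rewrite (sgnC b a) (sgnC c a) (sgnC c b).
rewrite -[RHS]scale1r; congr (_ *: _).
transitivity ((sg a b * sg a b) * (sg a c * sg a c) * (sg b c * sg b c)).
  by ring.
by rewrite !sgnV !mul1r.
Qed.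

(** The left-hand side of the co-Jacobi identity. *)
Definition cycsum u := u + tens_cyc u + tens_cyc (tens_cyc u).

Lemma cycsum_linear : linear cycsum.
Proof.
move=> c u v; rewrite /cycsum !linearP /= !scalerDr.
by rewrite (addrACA (c *: u)) (addrACA (c *: u + _)).
Qed.
HB.instance Definition _ :=
  GRing.isLinear.Build k _ _ _ cycsum cycsum_linear.

(** The invariance by which correction terms in the co-Jacobi identity are
matched with one another. *)
Lemma cycsum_cyc u : cycsum (tens_cyc u) = cycsum u.
Proof. by rewrite /cycsum tens_cyc3 addrC addrA. Qed.

Lemma tens_pr_even h x c : lsP false h = h ->
  tens_pr c (h ⊗ x) = h ⊗ lsP c x.
Proof.
move=> hh; elim/parity_ind: x => [x y hx hy|a x hx].
  by rewrite tpureDr !raddfD /= hx hy tpureDr.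
by rewrite (tens_pr_hom c hh hx) (lsP_hom _ hx) /=; case: ifP; rewrite ?tpure0r.
Qed.

Lemma tens_pr_evenr h x c : lsP false h = h ->
  tens_pr c (x ⊗ h) = lsP c x ⊗ h.
Proof.
move=> hh; elim/parity_ind: x => [x y hx hy|a x hx].
  by rewrite tpureDl !raddfD /= hx hy tpureDl.
by rewrite (tens_pr_hom c hx hh) (lsP_hom _ hx) addbF; case: ifP; rewrite ?tpure0l.
Qed.

Lemma tens_ad_evenl h y z : lsP false h = h ->
  tens_ad h (y ⊗ z) = lsB h y ⊗ z + y ⊗ lsB h z.
Proof.
move=> hh; elim/parity_ind: y => [y y' hy hy'|b y hy].
  by rewrite tpureDl !raddfD /= hy hy' !tpureDl addrACA.
by rewrite (tens_ad_hom _ hh hy) scale1r.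
Qed.

Lemma tens_ad_evenr x h h' : lsP false h = h -> lsP false h' = h' ->
  tens_ad x (h ⊗ h') = lsB x h ⊗ h' + h ⊗ lsB x h'.
Proof.
move=> hh hh'; elim/parity_ind: x => [x y hx hy|a x hx].
  rewrite (linfD (tens_ad_linearl _)) hx hy !lsBDl tpureDl tpureDr.
  by rewrite addrACA.
by rewrite (tens_ad_hom _ hx hh) sgn0r scale1r.
Qed.

Lemma lsP_even_br h x c : lsP false h = h -> lsP c (lsB h x) = lsB h (lsP c x).
Proof.
move=> hh; elim/parity_ind: x => [x y hx hy|a x hx]; first by rewrite !raddfD /= hx hy.
have := lsB_graded hh hx; rewrite /= => h1.
by rewrite (lsP_hom _ hx) (lsP_hom _ h1); case: ifP => _ //; rewrite linear0.
Qed.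

(** The tensor square is a module over the Lie superalgebra; this is why x.j is
a cocycle in x. *)
Lemma tens_ad_br a b x y t : lsP a x = x -> lsP b y = y ->
  tens_ad (lsB x y) t =
  tens_ad x (tens_ad y t) - sg a b *: tens_ad y (tens_ad x t).
Proof.
move=> hx hy; have hxy := lsB_graded hx hy.
elim/tens_parity_ind: t => [s t hs ht|c e u v hu hv].
  by rewrite !raddfD /= hs ht ?scalerDr ?opprD addrACA.
have jac w : lsB (lsB x y) w = lsB x (lsB y w) - sg a b *: lsB y (lsB x w).
  by rewrite (lsB_jacobi w hx hy) addrK.
have hxu := lsB_graded hx hu; have hyu := lsB_graded hy hu.
rewrite (tens_ad_hom _ hxy hu) (tens_ad_hom _ hy hu) (tens_ad_hom _ hx hu).
rewrite !(linfD (tens_ad_linear _)) !(linfZ (tens_ad_linear _)) (tens_ad_hom _ hx hyu) (tens_ad_hom _ hy hxu).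
rewrite (tens_ad_hom _ hx hu) (tens_ad_hom _ hy hu) !jac.
rewrite !tpureDl !tpureDr !tpureNl !tpureNr !tpureZl !tpureZr.
rewrite !scalerDr !scalerN !scalerA !opprD.
rewrite (sgnC (a (+) b) c) !sgnD (sgnC c a) (sgnC c b) (sgnC b a).
rewrite (mulrA _ _ (sg b c)) sgnV mul1r (mulrC (sg b c) (sg a c)).
rewrite [_ * _ * sg a b]mulrAC -[sg a c * sg a b]mulrC.
set p := _ ⊗ v; set q := sg a b *: _; set r := (_ * _) *: (u ⊗ lsB x _).
set s := _ *: (u ⊗ lsB y _); set m := _ *: (lsB y u ⊗ _).
set l := _ *: (lsB x u ⊗ _); rewrite (addrC (- q - l)).
rewrite (addrACA (p + m)) (addrA (p + m)) addrK (addrC l r) (addrC (- q) (- l)).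
by rewrite (addrA (r + l)) addrK addrACA [RHS]addrACA (addrC (- q)).
Qed.

End Homogeneous.

(** * Toral twists of Lie superbialgebras *)

Section ToralTwist.
Variables (k : fieldType) (g : lieSuperalgebra k) (t : nat) (H : 'I_t -> g).
Variable Theta : 'M[k]_t.
Hypotheses (H_even : forall i, lsP false (H i) = H i)
  (H_comm : forall i j, lsB (H i) (H j) = 0) (ThetaT : Theta^T = - Theta).

Definition toral_tensor : (g ⊗ g)%type :=
  \sum_(i < t) \sum_(l < t) Theta i l *: (H i ⊗ H l).

(** The element of the torus whose adjoint action is the derivation D_l
that the twist attaches to H_l. *)
Definition toral_dual (l : 'I_t) : g := \sum_(i < t) Theta i l *: H i.

Local Notation K := toral_dual.

Lemma toral_dual_even l : lsP false (K l) = K l.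
Proof.
rewrite /K raddf_sum /=; apply: eq_bigr => i _.
by rewrite linearZ /= H_even.
Qed.

Lemma toral_dual_br l i : lsB (K l) (H i) = 0.
Proof.
rewrite /K lsB_suml big1 // => j _.
by rewrite lsBZl H_comm scaler0.
Qed.

Lemma toral_dual_comm l l' x :
  lsB (K l) (lsB (K l') x) = lsB (K l') (lsB (K l) x).
Proof.
rewrite (lsB_jacobi _ (toral_dual_even l) (toral_dual_even l')) scale1r.
rewrite {2}/K lsB_sumr big1 ?lsB0l ?add0r // => i _.
by rewrite lsBZr toral_dual_br scaler0.
Qed.

(** The action of x on the twist, rewritten so that each term contains one element
of the torus and one derivative of x. *)
Definition toral_coboundary (x : g) : (g ⊗ g)%type :=
  \sum_(l < t) (H l ⊗ lsB (K l) x - lsB (K l) x ⊗ H l).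
Local Notation w := toral_coboundary.

(** Antisymmetry of Theta makes the two halves of x.j opposite to each other
up to the flip. *)
Lemma tens_ad_toral x : tens_ad x toral_tensor = w x.
Proof.
have e i l : tens_ad x (Theta i l *: (H i ⊗ H l)) =
    - (Theta i l *: (lsB (H i) x ⊗ H l)) - Theta i l *: (H i ⊗ lsB (H l) x).
  rewrite linearZ /= tens_ad_evenr // !(lsB_evenl x (H_even _)).
  by rewrite tpureNl tpureNr scalerDr !scalerN.
rewrite /toral_tensor raddf_sum /=.
under eq_bigr => i _ do rewrite raddf_sum /=.
under eq_bigr => i _ do under eq_bigr => l _ do rewrite e.
under eq_bigr => i _ do rewrite big_split /=.
rewrite big_split /= addrC /w big_split /=; congr (_ + _).
  apply: eq_bigr => i _; rewrite /K lsB_suml tpure_sumr.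
  apply: eq_bigr => l _; rewrite lsBZl tpureZr.
  by have /matrixP/(_ i l) := ThetaT; rewrite !mxE => ->; rewrite scaleNr.
rewrite exchange_big /=; apply: eq_bigr => l _.
rewrite /K lsB_suml tpure_suml -sumrN; apply: eq_bigr => i _.
by rewrite lsBZl tpureZl.
Qed.

Lemma toral_coboundary_linear : linear w.
Proof. by move=> c x y; rewrite -!tens_ad_toral tens_ad_linearl. Qed.

Lemma toral_coboundary_even c x : w (lsP c x) = tens_pr c (w x).
Proof.
rewrite /w raddf_sum /=; apply: eq_bigr => l _.
rewrite raddfB /= tens_pr_even // tens_pr_evenr //.
by rewrite lsP_even_br // toral_dual_even.
Qed.

Lemma toral_coboundary_anti x : tens_flip (w x) = - w x.
Proof.
rewrite /w raddf_sum /= -sumrN; apply: eq_bigr => l _.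
by rewrite raddfB /= tens_flip_even // tens_flip_evenr // opprB.
Qed.

Section Cojacobi.
Variable delta : g -> (g ⊗ g)%type.
Hypotheses (delta_lin : linear delta)
  (delta_flip : forall x, tens_flip (delta x) = - delta x)
  (delta_coj : forall x, cycsum (tmap delta id (delta x)) = 0)
  (delta_coc : forall a b x y, lsP a x = x -> lsP b y = y ->
     delta (lsB x y) = tens_ad x (delta y) - sgn k a b *: tens_ad y (delta x))
  (delta_H : forall i, delta (H i) = 0).

Lemma delta_toral_dual l : delta (K l) = 0.
Proof.
rewrite /K; elim/big_ind: _ => [|x y hx hy|i _]; first exact: linf0.
  by rewrite linfD // hx hy addr0.
by rewrite linfZ // delta_H scaler0.
Qed.

(** Elements of the torus have zero cobracket, so the cocycle identity says that
the derivations D_l are coderivations. *)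
Lemma delta_toral_br l x : delta (lsB (K l) x) = tens_ad (K l) (delta x).
Proof.
elim/parity_ind: x => [x y hx hy|b x hx].
  by rewrite lsBDr !(linfD delta_lin) hx hy raddfD.
rewrite (delta_coc (toral_dual_even l) hx) delta_toral_dual.
by rewrite linear0 scaler0 subr0.
Qed.

(** The correction terms linear in the twist. Writing u for the cobracket of x and
D for D_l, the terms H (x) D u' (x) u'' and D u' (x) u'' (x) H are cyclic
permutations of each other; so are D u' (x) H (x) u'' and u' (x) D u'' (x) H
after a flip of u, which accounts for the sign. *)
Lemma toral_cycle (l : 'I_t) u : tens_flip u = - u ->
  cycsum (tens_ad (K l) u ⊗ H l) =
  cycsum (tmap (fun y => H l ⊗ lsB (K l) y - lsB (K l) y ⊗ H l) id u).
Proof.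
set D := lsB (K l); move=> flip_u.
have lD : linear D by apply: lsB_linear.
have lid : linear (@id g) by [].
have lHD : linear (fun y => H l ⊗ D y).
  exact: (comp_linear ((tpure_bilin g g).2 (H l)) lD).
have lDH : linear (fun y => D y ⊗ H l).
  exact: (comp_linear ((tpure_bilin _ _).1 (H l)) lD).
have l1 : linear (tmap D (@id g)) by apply: tmap_linear.
have l2 : linear (tmap (@id g) D) by apply: tmap_linear.
have l3 : linear (tmap (fun y => H l ⊗ D y) (@id g)) by apply: tmap_linear.
have l4 : linear (tmap (fun y => D y ⊗ H l) (@id g)) by apply: tmap_linear.
have lA : linear (fun y => H l ⊗ D y - D y ⊗ H l).
  by move=> c x y; rewrite lHD lDH scalerBr opprD addrACA.
have eA : tmap (fun y => H l ⊗ D y - D y ⊗ H l) id u =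
    tmap (fun y => H l ⊗ D y) id u - tmap (fun y => D y ⊗ H l) id u.
  elim/tens_ind: u {flip_u} => [s s' hs hs'|x y].
    by rewrite (linfD (tmap_linear lA lid)) hs hs' (linfD l3) (linfD l4) opprD addrACA.
  by rewrite !tmap_pure // tpureDl tpureNl.
have eK : tens_ad (K l) u = tmap D id u + tmap id D u.
  elim/tens_ind: u {flip_u eA} => [s s' hs hs'|x y].
    by rewrite raddfD /= hs hs' (linfD l1) (linfD l2) addrACA.
  by rewrite tens_ad_evenl ?toral_dual_even // !tmap_pure.
have e1 : tens_cyc (tmap (fun y => H l ⊗ D y) id u) = tmap D id u ⊗ H l.
  elim/tens_ind: u {flip_u eA eK} => [s s' hs hs'|x y].
    by rewrite (linfD l3) raddfD /= hs hs' (linfD l1) tpureDl.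
  by rewrite !tmap_pure // tens_cyc_even.
have e2 : tens_cyc (tmap id D (tens_flip u) ⊗ H l) = tmap (fun y => D y ⊗ H l) id u.
  elim/tens_parity_ind: u {flip_u eA eK e1} => [s s' hs hs'|a b x y hx hy].
    by rewrite raddfD /= (linfD l2) tpureDl raddfD /= hs hs' (linfD l4).
  have hDx : lsP a (D x) = D x by rewrite lsP_even_br ?hx // toral_dual_even.
  rewrite (tens_flip_hom hx hy) (linfZ l2) !tmap_pure // tpureZl linearZ /=.
  rewrite (tens_cyc_hom hy hDx (H_even l)) addbF scalerA (sgnC _ a).
  by rewrite sgnV scale1r.
rewrite eA eK tpureDl raddfD raddfB /= -e1 cycsum_cyc; congr (_ + _).
rewrite -e2 cycsum_cyc flip_u.
by rewrite (linfN l2) tpureNl raddfN opprK.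
Qed.

(** The correction terms quadratic in the twist: a cyclic permutation exchanges the
roles of the two indices, and the derivations commute. *)
Lemma toral_double_cycle x :
  cycsum (\sum_(l < t) (w (lsB (K l) x) ⊗ H l)) = 0.
Proof.
pose F l m := cycsum (lsB (K m) (lsB (K l) x) ⊗ H l ⊗ H m).
have e l : cycsum (w (lsB (K l) x) ⊗ H l) =
    \sum_(m < t) F l m - \sum_(m < t) F m l.
  rewrite /w tpure_suml raddf_sum -sumrB; apply: eq_bigr => m _ /=.
  rewrite tpureDl tpureNl raddfB /= -(cycsum_cyc (H m ⊗ _ ⊗ _)).
  by rewrite tens_cyc_even // /F toral_dual_comm.
rewrite raddf_sum /=; under eq_bigr => l _ do rewrite e.
by rewrite sumrB exchange_big subrr.
Qed.

Lemma toral_cojacobi x :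
  cycsum (tmap (fun y => delta y - w y) id (delta x - w x)) = 0.
Proof.
have lid : linear (@id g) by [].
have lw := toral_coboundary_linear.
set dj := fun y => _.
have ldj : linear dj.
  by move=> c y z; rewrite /dj delta_lin lw scalerBr opprD addrACA.
have djH i : dj (H i) = 0.
  rewrite /dj delta_H /w big1 ?subr0 // => l _.
  by rewrite toral_dual_br tpure0l tpure0r subr0.
have dw : tmap dj id (w x) =
    \sum_(l < t) (w (lsB (K l) x) ⊗ H l) -
    \sum_(l < t) (tens_ad (K l) (delta x) ⊗ H l).
  rewrite {1}/w (linf_sum (tmap_linear ldj lid)) -sumrB; apply: eq_bigr => l _.
  rewrite (linfB (tmap_linear ldj lid)) !tmap_pure // djH tpure0l sub0r.
  by rewrite {1}/dj delta_toral_br tpureDl tpureNl opprD opprK addrC.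
pose a l y := H l ⊗ lsB (K l) y - lsB (K l) y ⊗ H l.
have la l : linear (a l).
  move=> c y z; rewrite /a linearP /= tpureDl tpureDr tpureZl tpureZr.
  by rewrite scalerBr opprD addrACA.
have dd (u : (g ⊗ g)%type) : tmap dj id u = tmap delta id u - \sum_(l < t) tmap (a l) id u.
  elim/tens_ind: u => [s s' hs hs'|y z].
    rewrite (linfD (tmap_linear ldj lid)) (linfD (tmap_linear delta_lin lid)) hs hs' addrACA -opprD -big_split /=.
    congr (_ - _); apply: eq_bigr => l _.
    by rewrite (linfD (tmap_linear (la l) lid)).
  rewrite !tmap_pure // /dj tpureDl tpureNl /w tpure_suml.
  by congr (_ - _); apply: eq_bigr => l _; rewrite tmap_pure.
rewrite (linfB (tmap_linear ldj lid)) dw dd !raddfB /= delta_coj.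
rewrite toral_double_cycle !sub0r opprK.
apply/eqP; rewrite addrC subr_eq0 !raddf_sum /=; apply/eqP.
by rewrite oppr0 add0r; apply: eq_bigr => l _; apply: toral_cycle.
Qed.

End Cojacobi.
End ToralTwist.

(** The cocycle condition holds because x.j is a coboundary; the co-Jacobi
identity uses that j lies in the square of a torus on which the cobracket vanishes. *)
Lemma toral_twist_lieSuperbialgebra (k : fieldType) (g : cobracketed k)
    (t : nat) (H : 'I_t -> g) (Theta : 'M[k]_t) :
  is_lieSuperbialgebra g ->
  (forall i, lsP false (H i) = H i) -> (forall i j, lsB (H i) (H j) = 0) ->
  (forall i, cb_delta (H i) = 0) -> Theta^T = - Theta ->
  is_lieSuperbialgebra (twist_deformation (toral_tensor H Theta)).
Proof.
case=> lin even anti coj coc H_even H_comm dH ThetaT.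
have adE := tens_ad_toral H_even ThetaT.
split=> /=.
- by move=> c x y; rewrite lin tens_ad_linearl scalerBr opprD addrACA.
- by move=> b x; rewrite raddfB /= even !adE toral_coboundary_even.
- by move=> x; rewrite raddfB /= anti adE toral_coboundary_anti // opprB opprK addrC.
- move=> x.
  have := toral_cojacobi H_even H_comm ThetaT lin anti coj coc dH x.
  congr (cycsum _ = _); rewrite -adE; congr (tmap _ _ _).
  by apply: boolp.funext => y; rewrite adE.
- move=> a b x y hx hy; rewrite (coc a b) // (tens_ad_br _ hx hy) !raddfB /=.
  by rewrite addrACA.
Qed.

(** * Transport of structure *)

Section Transport.
Variables (k : fieldType) (g : cobracketed k) (L : lieSuperalgebra k).
Variables (phi : g -> L) (psi : L -> g).
Hypotheses (phi_lin : linear phi) (phiK : cancel phi psi) (psiK : cancel psi phi)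
  (phiP : forall b x, phi (lsP b x) = lsP b (phi x))
  (phiB : forall x y, phi (lsB x y) = lsB (phi x) (phi y)).

Definition transported_cobracket (y : L) : (L ⊗ L)%type :=
  tmap phi phi (cb_delta (psi y)).

Local Notation phi2 := (tmap phi phi).

Let phi2_lin : linear phi2.
Proof. exact: tmap_linear. Qed.

Let phi_hom a x : lsP a x = x -> lsP a (phi x) = phi x.
Proof. by move=> hx; rewrite -phiP hx. Qed.

Let psi_lin : linear psi.
Proof.
by move=> c x y; apply: (can_inj phiK); rewrite phi_lin !psiK.
Qed.

Let psiP b y : psi (lsP b y) = lsP b (psi y).
Proof. by apply: (can_inj phiK); rewrite phiP !psiK. Qed.

Let psiB x y : psi (lsB x y) = lsB (psi x) (psi y).
Proof. by apply: (can_inj phiK); rewrite phiB !psiK. Qed.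

Lemma tens_pr_tmap c u : tens_pr c (phi2 u) = phi2 (tens_pr c u).
Proof.
elim/tens_parity_ind: u => [s t hs ht|a b x y hx hy].
  by rewrite (linfD phi2_lin) !raddfD /= (linfD phi2_lin) hs ht.
rewrite tmap_pure // (tens_pr_hom _ hx hy) (tens_pr_hom c (phi_hom hx) (phi_hom hy)).
by case: ifP => _; rewrite ?tmap_pure // (linf0 phi2_lin).
Qed.

Lemma tens_flip_tmap u : tens_flip (phi2 u) = phi2 (tens_flip u).
Proof.
elim/tens_parity_ind: u => [s t hs ht|a b x y hx hy].
  by rewrite (linfD phi2_lin) !raddfD /= (linfD phi2_lin) hs ht.
rewrite tmap_pure // (tens_flip_hom hx hy) (linfZ phi2_lin) tmap_pure //.
by rewrite (tens_flip_hom (phi_hom hx) (phi_hom hy)).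
Qed.

Lemma tens_cyc_tmap u :
  tens_cyc (tmap phi2 phi u) = tmap phi2 phi (tens_cyc u).
Proof.
have l3 := tmap_linear phi2_lin phi_lin.
elim/tens3_parity_ind: u => [s t hs ht|a b c x y z hx hy hz].
  by rewrite (linfD l3) !raddfD /= (linfD l3) hs ht.
rewrite (tens_cyc_hom hx hy hz) (linfZ l3) !tmap_pure //.
by rewrite (tens_cyc_hom (phi_hom hx) (phi_hom hy) (phi_hom hz)).
Qed.

Lemma tens_ad_tmap x u : tens_ad (phi x) (phi2 u) = phi2 (tens_ad x u).
Proof.
elim/parity_ind: x => [x x' hx hx'|a x hx].
  rewrite (linfD phi_lin) !(linfD (tens_ad_linearl _)) hx hx'.
  by rewrite (linfD phi2_lin).
elim/tens_parity_ind: u => [s t hs ht|b c y z hy hz].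
  by rewrite (linfD phi2_lin) !raddfD /= (linfD phi2_lin) hs ht.
rewrite tmap_pure // (tens_ad_hom _ hx hy) (linfD phi2_lin) (linfZ phi2_lin).
by rewrite !tmap_pure // !phiB (tens_ad_hom _ (phi_hom hx) (phi_hom hy)).
Qed.

Lemma transport_lieSuperbialgebra :
  is_lieSuperbialgebra g -> is_lieSuperbialgebra (Cobracketed transported_cobracket).
Proof.
case=> lin even anti coj coc; rewrite /transported_cobracket; split=> /=.
- by move=> c x y; rewrite psi_lin lin phi2_lin.
- by move=> b x; rewrite psiP even tens_pr_tmap.
- by move=> x; rewrite tens_flip_tmap anti (linfN phi2_lin).
- move=> x; set d' := fun y => _.
  have ld' : linear d' by move=> c y z; rewrite /d' psi_lin lin phi2_lin.
  have lid (V : lmodType k) : linear (@id V) by [].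
  have l3 := tmap_linear phi2_lin phi_lin.
  have e u : tmap d' id (phi2 u) = tmap phi2 phi (tmap (@cb_delta k g) id u).
    elim/tens_ind: u => [s t hs ht|y z].
      rewrite (linfD phi2_lin) !(linfD (tmap_linear _ _)) //.
      by rewrite hs ht.
    by rewrite !tmap_pure // /d' phiK.
  rewrite {1 2 3}/d' !e !tens_cyc_tmap -!(linfD l3).
  by rewrite coj (linf0 l3).
move=> a b x y hx hy.
have hx' : lsP a (psi x) = psi x by rewrite -psiP hx.
have hy' : lsP b (psi y) = psi y by rewrite -psiP hy.
rewrite psiB (coc a b) // (linfB phi2_lin) (linfZ phi2_lin) -!tens_ad_tmap.
by rewrite !psiK.
Qed.

Lemma transport_iso : lieSuperbialgebra_iso (Cobracketed transported_cobracket) g.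
Proof.
exists psi; split=> //; first by exists phi.
move=> x /=; rewrite /transported_cobracket.
elim/tens_ind: (cb_delta _) => [s t hs ht|y z].
  by rewrite (linfD phi2_lin) (linfD (tmap_linear psi_lin psi_lin)) -hs -ht.
by rewrite !tmap_pure // !phiK.
Qed.

End Transport.

(** * Functoriality of presented Lie superalgebras *)

Section PresentedMap.
Variables (k : fieldType) (G G' : Type) (par : G -> bool) (par' : G' -> bool).
Variables (r : lexpr k G -> Prop) (r' : lexpr k G' -> Prop) (f : G -> G').

Fixpoint lmap (e : lexpr k G) : lexpr k G' :=
  match e with
  | LZero => LZero k G'
  | LAdd x y => LAdd (lmap x) (lmap y)
  | LScale a x => LScale a (lmap x)
  | LGen x => LGen k (f x)
  | LBr x y => LBr (lmap x) (lmap y)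
  end.

Hypotheses (parf : forall x, par' (f x) = par x)
  (rf : forall e, r e -> r' (lmap e)).

Lemma lmap_lpr b e : lmap (lpr par b e) = lpr par' b (lmap e).
Proof.
elim: e b => [|x hx y hy|a x hx|x|x hx y hy] b //=; rewrite ?hx ?hy //.
by rewrite parf; case: ifP.
Qed.

Lemma lmap_rel x y : lrel par r x y -> lrel par' r' (lmap x) (lmap y).
Proof.
elim=> {x y} /=; try by intros; constructor.
- by move=> x y z _ h _; apply: lrel_trans.
- by move=> a b x y; rewrite !lmap_lpr; apply: lrel_anti.
- by move=> a b x y z; rewrite !lmap_lpr; apply: lrel_jacobi.
- by move=> b e re; rewrite lmap_lpr; apply/lrel_relator/rf.
Qed.

Definition presented_map (q : presented par r) : presented par' r' :=
  pcls par' r' (lmap (@rep k (lie_precongr par r) q)).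

Lemma presented_mapE e : presented_map (pcls par r e) = pcls par' r' (lmap e).
Proof.
apply/(@clsP k (lie_precongr par' r')); apply: lmap_rel.
exact: (@rep_cls k (lie_precongr par r)).
Qed.

Lemma presented_map_linear : linear presented_map.
Proof.
move=> c x y; have [[e ->] [e' ->]] := (pcls_surj x, pcls_surj y).
by rewrite -pclsZ -pclsD !presented_mapE /= pclsD pclsZ.
Qed.

Lemma presented_mapP b x : presented_map (lsP b x) = lsP b (presented_map x).
Proof.
have [e ->] := pcls_surj x.
by rewrite pclsP !presented_mapE pclsP lmap_lpr.
Qed.

Lemma presented_mapB x y :
  presented_map (lsB x y) = lsB (presented_map x) (presented_map y).
Proof.
have [[e ->] [e' ->]] := (pcls_surj x, pcls_surj y).
by rewrite -pclsB !presented_mapE /= pclsB.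
Qed.

End PresentedMap.

Lemma lmapK (k : fieldType) (G G' : Type) (f : G -> G') (f' : G' -> G) :
  cancel f f' -> cancel (@lmap k G G' f) (lmap f').
Proof. by move=> fK; elim=> //= [x -> y ->|a x ->|x|x -> y ->] //; rewrite fK. Qed.

(** * Twists of multiparameter Lie superbialgebras *)

Section Functoriality.
Variables (k : fieldType) (n : nat) (D : diagram n) (d : 'I_n -> rat).

Definition mpgen_map (R R' : realization k n) (f : re_h R -> re_h R')
    (x : mpgen R) : mpgen R' :=
  match x with
  | GH T => GH (f T)
  | GE i => GE R' i
  | GF i => GF R' i
  end.

(** A linear map between Cartan subalgebras induces a morphism as soon as it
respects the roots and the sums of the coroots, since only these occur in the
relations. *)
Lemma mp_relator_map (R R' : realization k n) (f : re_h R -> re_h R') e :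
  linear f ->
  (forall i T, re_alpha R' i (f T) = re_alpha R i T) ->
  (forall i, f (re_Tp R i + re_Tm R i) = re_Tp R' i + re_Tm R' i) ->
  mp_relator D d e -> mp_relator D d (lmap (mpgen_map f) e).
Proof.
move=> lf fa fT; have mX s i : lmap (mpgen_map f) (mpX R s i) = mpX R' s i.
  by case: s.
case=> {e} /=.
- by move=> c T T'; rewrite lf; apply: mp_lin.
- by move=> T T'; apply: mp_HH.
- by move=> T j; rewrite -fa; apply: mp_HE.
- by move=> T j; rewrite -fa; apply: mp_HF.
- by move=> i; rewrite fT; apply: mp_EF.
- by move=> i l; apply: mp_EF0.
- by move=> s i j; rewrite !mX; apply: mp_comm.
- move=> s i j ij pi.
  have -> m : lmap (mpgen_map f) (iter m (fun x => LBr (mpX R s i) x) (mpX R s j))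
      = iter m (fun x => LBr (mpX R' s i) x) (mpX R' s j).
    by elim: m => //= m ->; rewrite mX.
  exact: mp_serre.
- by move=> s i j l h; rewrite !mX; apply: mp_rel1 h.
- by move=> s i j h1 h2 h3; rewrite !mX; apply: mp_rel2.
- by move=> s i j l h1 h2 h3 h4; rewrite !mX; apply: mp_rel3.
- by move=> s i j l h1 h2 h3 h4 h5 h6; rewrite !mX; apply: mp_rel4.
- by move=> s h i j l h1 h2 h3 h4 h5 h6 h7; rewrite !mX; apply: mp_rel5.
Qed.

End Functoriality.

Section Generators.
Variables (k : fieldType) (n : nat) (D : diagram n) (d : 'I_n -> rat).
Variable R : realization k n.
Local Notation mpH := (mpH D d).
Local Notation mpE := (mpE D d R).
Local Notation mpF := (mpF D d R).

Lemma pcls_eq (G : Type) (par : G -> bool) (r : lexpr k G -> Prop) x y :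
  r (LAdd x (LScale (- 1) y)) -> pcls par r x = pcls par r y.
Proof.
by move/(pcls_relator par); rewrite pclsD pclsZ scaleN1r => /eqP;
   rewrite subr_eq0 => /eqP.
Qed.

Lemma mpH_linear : linear (@Defs.mpH k n D d R).
Proof.
by move=> c T T'; rewrite /mpH (pcls_eq _ (mp_lin _ _ _ _ _)) pclsD pclsZ.
Qed.

Lemma mpH_even T : lsP false (mpH T) = mpH T :> mp_alg D d R.
Proof. by rewrite /mpH pclsP. Qed.

Lemma mpH_comm T T' : lsB (mpH T) (mpH T') = 0 :> mp_alg D d R.
Proof. by rewrite /mpH -pclsB (pcls_eq _ (mp_HH _ _ _ _)). Qed.

Lemma mpHE T i : lsB (mpH T) (mpE i) = (re_alpha R i T : k) *: mpE i.
Proof. by rewrite -pclsB (pcls_eq _ (mp_HE _ _ _ _)) pclsZ. Qed.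

Lemma mpHF T i : lsB (mpH T) (mpF i) = (- (re_alpha R i T : k)) *: mpF i.
Proof. by rewrite -pclsB (pcls_eq _ (mp_HF _ _ _ _)) pclsZ. Qed.

Hypothesis two_neq0 : (2 : k) != 0.

Lemma wedge_even (L : lieSuperalgebra k) (h x : L) : lsP false h = h ->
  2 *: wedge h x = h ⊗ x - x ⊗ h.
Proof.
by move=> hh; rewrite /wedge tens_flip_even // scalerA mulfV // scale1r.
Qed.

(** On a weight vector x of weight mu, each D_l acts by a scalar, so x.j is
v (x) x - x (x) v for the vector v of the torus below; this is how a twist
shifts the coroots. *)
Lemma toral_coboundary_weight (t : nat) (H : t.-tuple (re_h R)) (Theta : 'M[k]_t)
    (mu : re_h R -> k) (x : mp_alg D d R) (v : re_h R) :
  (forall T, lsB (mpH T) x = mu T *: x) ->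
  v = \sum_(i < t) \sum_(l < t) (Theta i l * mu (tnth H i)) *: tnth H l ->
  toral_coboundary (fun i => mpH (tnth H i)) Theta x = mpH v ⊗ x - x ⊗ mpH v.
Proof.
move=> hx ->; pose c l := \sum_(i < t) Theta i l * mu (tnth H i).
have -> : \sum_(i < t) \sum_(l < t) (Theta i l * mu (tnth H i)) *: tnth H l =
    \sum_(l < t) c l *: tnth H l.
  by rewrite exchange_big; apply: eq_bigr => l _; rewrite -scaler_suml.
rewrite (linf_sum mpH_linear) tpure_suml tpure_sumr -sumrB /toral_coboundary.
apply: eq_bigr => l _; rewrite (linfZ mpH_linear) tpureZl tpureZr.
have -> : lsB (toral_dual (fun i => mpH (tnth H i)) Theta l) x = c l *: x.
  rewrite /toral_dual lsB_suml scaler_suml; apply: eq_bigr => i _.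
  by rewrite lsBZl hx scalerA.
by rewrite tpureZl tpureZr.
Qed.

End Generators.

Section Deformation.
Variables (k : fieldType) (n : nat) (D : diagram n) (d : 'I_n -> rat).
Variables (R R' : realization k n) (t : nat) (H : t.-tuple (re_h R)).
Variables (Theta : 'M[k]_t) (f : re_h R -> re_h R') (f' : re_h R' -> re_h R).
Hypotheses (two_neq0 : (2 : k) != 0) (ThetaT : Theta^T = - Theta).
Hypotheses (lf : linear f) (fK : cancel f f') (f'K : cancel f' f).
Hypothesis falpha : forall i T, re_alpha R' i (f T) = re_alpha R i T.
Hypothesis fTp : forall i, f (re_Tp R i + twist_vec H Theta i) = re_Tp R' i.
Hypothesis fTm : forall i, f (re_Tm R i - twist_vec H Theta i) = re_Tm R' i.

Let pR := @mppar k n D R.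
Let pR' := @mppar k n D R'.
Let Rt := mp_relator D d (R := R).
Let Rt' := mp_relator D d (R := R').

(** The twist cancels in the sums of the coroots, so the two realizations have
isomorphic Lie superalgebras. *)
Lemma mp_alg_twist_iso : exists (phi : mp_alg D d R -> mp_alg D d R') psi,
  [/\ linear phi, cancel phi psi, cancel psi phi,
      forall b x, phi (lsP b x) = lsP b (phi x) &
      forall x y, phi (lsB x y) = lsB (phi x) (phi y)] /\
  [/\ forall T, phi (mpH D d T) = mpH D d (f T),
      forall i, phi (mpE D d R i) = mpE D d R' i &
      forall i, phi (mpF D d R i) = mpF D d R' i].
Proof.
have lf' : linear f'.
  by move=> c x y; apply: (can_inj fK); rewrite lf !f'K.
have fS i : f (re_Tp R i + re_Tm R i) = re_Tp R' i + re_Tm R' i.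
  by rewrite -fTp -fTm -(linfD lf) addrACA subrr addr0.
have rf e := mp_relator_map (D := D) (d := d) (e := e) lf falpha fS.
have rf' e : mp_relator D d e -> mp_relator D d (lmap (mpgen_map f') e).
  apply: mp_relator_map lf' _ _ => [i T|i]; first by rewrite -falpha f'K.
  by apply: (can_inj fK); rewrite fS f'K.
have parf (x : mpgen R) : mppar D (mpgen_map f x) = mppar D x by case: x.
have parf' (x : mpgen R') : mppar D (mpgen_map f' x) = mppar D x by case: x.
have gK : cancel (mpgen_map f) (mpgen_map f') by case=> //= T; rewrite fK.
have g'K : cancel (mpgen_map f') (mpgen_map f) by case=> //= T; rewrite f'K.
exists (@presented_map k _ _ pR pR' Rt Rt' (mpgen_map f)).
exists (@presented_map k _ _ pR' pR Rt' Rt (mpgen_map f')).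
have mE := @presented_mapE k _ _ pR pR' Rt Rt' _ parf rf.
have mE' := @presented_mapE k _ _ pR' pR Rt' Rt _ parf' rf'.
split; split.
- exact: (presented_map_linear parf rf).
- by move=> q; have [e ->] := pcls_surj q; rewrite mE mE' lmapK.
- by move=> q; have [e ->] := pcls_surj q; rewrite mE' mE lmapK.
- exact: (presented_mapP parf rf).
- exact: (presented_mapB parf rf).
- by move=> T; apply: mE.
- by move=> i; apply: mE.
- by move=> i; apply: mE.
Qed.

(** The deformed cobracket, carried over by the isomorphism of Lie superalgebras,
takes the right values on the generators: the vector v of
[toral_coboundary_weight] is minus the twisting vector on E_i, of weight alpha_i, and plus the twisting vector
on F_i, of weight - alpha_i. *)
Theorem mplsba_toral_deformation (g : mplsba D d R) :
  exists g' : mplsba D d R', lieSuperbialgebra_iso g' (toral_deformation H Theta g).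
Proof.
have [phi [psi [[philin phiK psiK phiP phiB] [phiH phiE phiF]]]] := mp_alg_twist_iso.
pose gt : cobracketed k := toral_deformation H Theta g.
pose Hm i : mp_alg D d R := mpH D d (tnth H i).
have Heven i : lsP false (Hm i) = Hm i by apply: mpH_even.
have Hcomm i j : lsB (Hm i) (Hm j) = 0 by apply: mpH_comm.
have gtP : is_lieSuperbialgebra gt.
  apply: (toral_twist_lieSuperbialgebra (g := g) (mp_lsb g) Heven Hcomm _ ThetaT).
  by move=> i; apply: mp_deltaH.
have gtE x : cb_delta (c := gt) x = mp_delta g x - toral_coboundary Hm Theta x.
  by rewrite /= (tens_ad_toral Heven ThetaT).
pose delta' := @transported_cobracket k gt (mp_alg D d R') phi psi.
have lP := @transport_lieSuperbialgebra k gt (mp_alg D d R') phi psi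
  philin phiK psiK phiP phiB gtP.
have psiE x y : phi x = y -> psi y = x by move=> <-; rewrite phiK.
have phi2lin := tmap_linear philin philin.
have tw i : twist_vec H Theta i = \sum_(j < t) \sum_(l < t)
    (Theta j l * - (re_alpha R i (tnth H j) : k)) *: tnth H l.
  rewrite /twist_vec; apply: eq_bigr => j _; apply: eq_bigr => l _.
  have /matrixP/(_ j l) := ThetaT; rewrite !mxE => ->.
  by rewrite !mulrN mulrC.
have twN i : - twist_vec H Theta i = \sum_(j < t) \sum_(l < t)
    (Theta j l * (re_alpha R i (tnth H j) : k)) *: tnth H l.
  rewrite tw -sumrN; apply: eq_bigr => j _; rewrite -sumrN.
  by apply: eq_bigr => l _; rewrite mulrN scaleNr opprK.
have dH T : delta' (mpH D d T) = 0.
  rewrite /delta' /transported_cobracket (psiE (mpH D d (f' T))); last first.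
    by rewrite phiH f'K.
  rewrite gtE mp_deltaH sub0r (toral_coboundary_weight (mu := fun=> 0) (v := 0)).
  - by rewrite (linf0 (@mpH_linear k n D d R)) tpure0l tpure0r subrr oppr0 (linf0 phi2lin).
  - by move=> T'; rewrite scale0r; apply: mpH_comm.
  - by rewrite big1 // => j _; rewrite big1 // => l _; rewrite mulr0 scale0r.
have lH := @mpH_linear k n D d R.
have sub v T (x : mp_alg D d R) :
    (mpH D d T ⊗ x - x ⊗ mpH D d T) - (mpH D d (- v) ⊗ x - x ⊗ mpH D d (- v)) =
    mpH D d (T + v) ⊗ x - x ⊗ mpH D d (T + v).
  rewrite (linfD lH) (linfN lH) tpureDl tpureDr !tpureNl !tpureNr !opprD !opprK.
  by rewrite addrACA.
have wE i : toral_coboundary Hm Theta (mpE D d R i) =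
    mpH D d (- twist_vec H Theta i) ⊗ mpE D d R i -
    mpE D d R i ⊗ mpH D d (- twist_vec H Theta i).
  apply: (toral_coboundary_weight (mu := fun T => re_alpha R i T)) => [T|].
    exact: mpHE.
  exact: twN.
have wF i : toral_coboundary Hm Theta (mpF D d R i) =
    mpH D d (- - twist_vec H Theta i) ⊗ mpF D d R i -
    mpF D d R i ⊗ mpH D d (- - twist_vec H Theta i).
  apply: (toral_coboundary_weight (mu := fun T => - (re_alpha R i T : k))) => [T|].
    exact: mpHF.
  by rewrite opprK tw.
have dE i : delta' (mpE D d R' i) = 2 *: wedge (mpH D d (re_Tp R' i)) (mpE D d R' i).
  rewrite /delta' /transported_cobracket (psiE _ _ (phiE i)) gtE mp_deltaE.
  rewrite !wedge_even ?mpH_even //.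
  rewrite wE sub.
  by rewrite (linfB phi2lin) !tmap_pure // phiH fTp phiE.
have dF i : delta' (mpF D d R' i) = 2 *: wedge (mpH D d (re_Tm R' i)) (mpF D d R' i).
  rewrite /delta' /transported_cobracket (psiE _ _ (phiF i)) gtE mp_deltaF.
  rewrite !wedge_even ?mpH_even //.
  rewrite wF sub.
  by rewrite (linfB phi2lin) !tmap_pure // phiH fTm phiF.
exists (Mplsba lP dH dE dF).
exact: (@transport_iso k gt (mp_alg D d R') phi psi philin phiK psiK phiP phiB).
Qed.

(** A cobracket is determined by its values on generators, so the structure on the
target may be prescribed in advance. *)
Corollary mplsba_iso_toral_deformation (g : mplsba D d R) (g' : mplsba D d R') :
  lieSuperbialgebra_iso g' (toral_deformation H Theta g).
Proof.
have [g'' [phi [lphi bphi phiP phiB phid]]] := mplsba_toral_deformation g.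
exists phi; split=> // x; rewrite phid /=; congr (tmap _ _ _).
exact: mplsba_unique.
Qed.

End Deformation.

(** * Linear algebra *)

Section MatrixLemmas.
Variable F : fieldType.

(** In a basis where A = (1 0), a matrix Theta with A Theta = M has M as its
upper rows, the upper left block of M being M A^T; what is missing is filled in
by antisymmetry. The witness below is the coordinate-free form, with B a right
inverse of A: the first two terms count the block M A^T twice, and the last
removes the excess. *)
Lemma antisymmetric_factor (n t : nat) (A M : 'M[F]_(n, t)) :
  row_free A -> (M *m A^T)^T = - (M *m A^T) ->
  exists2 Theta : 'M[F]_t, Theta^T = - Theta & A *m Theta = M.
Proof.
move=> /row_freeP[B AB] MA.
have BA : B^T *m A^T = 1%:M by rewrite -trmx_mul AB trmx1.
have AM : A *m M^T = - (M *m A^T) by rewrite -MA trmx_mul trmxK.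
pose N := M *m A^T; have NT : N^T = - N by [].
have ZT : (B *m N *m B^T)^T = - (B *m N *m B^T).
  by rewrite trmx_mul trmxK (trmx_mul B) NT mulNmx mulmxN mulmxA.
exists (B *m M - M^T *m B^T - B *m N *m B^T).
  by rewrite 2!linearB /= ZT !trmx_mul !trmxK opprB opprB opprK addrC.
by rewrite !mulmxBr !mulmxA AB !mul1mx AM mulNmx opprK addrK.
Qed.

Lemma antisymmetric_congruence (n t : nat) (A : 'M[F]_(n, t))
    (L : 'M_n) :
  row_free A -> L^T = - L ->
  exists2 Theta : 'M_t, Theta^T = - Theta & A *m Theta *m A^T = L.
Proof.
move=> /row_freeP[B AB] LT; exists (B *m L *m B^T).
  by rewrite trmx_mul trmxK trmx_mul LT mulNmx mulmxN mulmxA.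
by rewrite -!mulmxA -trmx_mul AB trmx1 mulmx1 mulmxA AB mul1mx.
Qed.

Lemma row_free_pid (n m : nat) (s : 'M[F]_(n, n + m)) : row_free s ->
  exists2 g, g \in unitmx & s *m g = row_mx 1%:M 0.
Proof.
move=> fs; have [f e] : exists f : 'M_(n + m), s *m f = row_mx 1%:M 0.
  have /row_freeP[r sr] := fs; exists (r *m row_mx 1%:M 0).
  by rewrite mulmxA sr mul1mx.
have rk : \rank (s *m f) = \rank s.
  rewrite e; move: fs; rewrite /row_free => /eqP ->; apply/eqP.
  apply/row_freeP; exists (col_mx 1%:M 0).
  by rewrite mul_row_col mul1mx mul0mx addr0.
by have [g ug sg] := complete_unitmx rk; exists g; rewrite // -sg.
Qed.

(** The lower blocks of B and B' have the same row space modulo their common upper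
block M, since each spans everything together with M. Being of the same size,
they are related there by an invertible matrix Y; the discrepancy modulo M is
corrected by X. *)
Lemma unitmx_extend (n m : nat) (B B' : 'M[F]_(n + m, n)) :
  row_full B -> row_full B' -> usubmx B = usubmx B' ->
  exists2 g, g \in unitmx &
    row_mx 1%:M 0 *m g = row_mx 1%:M 0 :> 'M_(n, n + m) /\ g *m B' = B.
Proof.
move=> fB fB' eM; set M := usubmx B'.
have W_eq (C : 'M_(n + m, n)) : row_full C -> usubmx C = M ->
    (dsubmx C *m cokermx M :=: cokermx M)%MS.
  move=> fC eC; apply/eqmxP; rewrite submxMl /=.
  have := fC; rewrite -sub1mx => /submxP[E].
  rewrite -[C]vsubmxK -[E]hsubmxK mul_row_col eC => e1.
  rewrite -[X in (X <= _)%MS]mul1mx e1 mulmxDl -!mulmxA mulmx_coker mulmx0 add0r.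
  by rewrite col_mxKd submxMl.
have /eqmxMunitP[Y uY eY] : (dsubmx B *m cokermx M == dsubmx B' *m cokermx M)%MS.
  apply/eqmxP.
  exact: (eqmx_trans (W_eq B fB eM) (eqmx_sym (W_eq B' fB' (erefl M)))).
have /submxP[X eX] : (dsubmx B - Y *m dsubmx B' <= M)%MS.
  by rewrite submxE mulmxBl eY mulmxA subrr.
exists (block_mx 1%:M 0 X Y).
  by rewrite unitmxE det_lblock det1 mul1r -unitmxE.
split.
  by rewrite mul_row_block !mul1mx !mul0mx !addr0.
rewrite -[B']vsubmxK mul_block_col mul1mx mul0mx addr0 -eX subrK.
have -> : usubmx B' = usubmx B by [].
exact: vsubmxK.
Qed.

(** A square matrix has at most one factorization, up to isomorphism, as an injection
into a space of given dimension followed by a surjection. *)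
Lemma factorization_unique (n t t' : nat) (s : 'M[F]_(n, t)) (s' : 'M_(n, t'))
    (B : 'M_(t, n)) (B' : 'M_(t', n)) :
  t = t' -> row_free s -> row_free s' -> row_full B -> row_full B' ->
  s *m B = s' *m B' ->
  exists g g', [/\ g *m g' = 1%:M, g' *m g = 1%:M, s *m g = s' & g *m B' = B].
Proof.
move=> ett; move: s' B'; rewrite -{t'}ett => s' B' fs fs' fB fB' e.
have [m tE] : exists m, t = (n + m)%N.
  exists (t - n)%N; rewrite subnKC //.
  by move: fs; rewrite /row_free => /eqP <-; apply: rank_leq_col.
move: s s' B B' fs fs' fB fB' e; rewrite {t}tE => s s' B B' fs fs' fB fB' e.
have [[h uh sh] [h' uh' sh']] := (row_free_pid fs, row_free_pid fs').
have uE C : usubmx C = row_mx 1%:M 0 *m C :> 'M_n.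
  by rewrite -[C in RHS]vsubmxK mul_row_col mul1mx mul0mx addr0.
have full x C : x \in unitmx -> row_full C -> row_full (invmx x *m C).
  by move=> ux; rewrite /row_full eqmxMfull // row_full_unit unitmx_inv.
have [] := @unitmx_extend n m (invmx h *m B) (invmx h' *m B').
- exact: full.
- exact: full.
- by rewrite !uE -{1}sh -sh' !mulmxA !mulmxK.
move=> y uy [y1 y2]; have uv : h *m y *m invmx h' \in unitmx.
  by rewrite !unitmx_mul uh uy unitmx_inv.
exists (h *m y *m invmx h'), (invmx (h *m y *m invmx h')); split.
- exact: mulmxV.
- exact: mulVmx.
- by rewrite !mulmxA sh y1 -sh' mulmxK.
- by rewrite -!mulmxA y2 mulKVmx.
Qed.

End MatrixLemmas.

Lemma free_enum (F : fieldType) (V : vectType F) (n : nat) (f : 'I_n -> V)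
    (c : 'I_n -> F) :
  free [seq f i | i <- enum 'I_n] -> \sum_i c i *: f i = 0 -> forall i, c i = 0.
Proof.
move=> fr e; have /freeP h : free [tuple f i | i < n] := fr.
apply: (h c).
by rewrite -[RHS]e; apply: eq_bigr => i _; rewrite -tnth_nth tnth_mktuple.
Qed.

(** * Realizations *)

Section Realizations.
Import passmx.
Variables (k : fieldType) (n : nat).

Lemma rootmxE (R : realization k n) (t : nat) (H : t.-tuple (re_h R)) (c : 'rV[k]_t) j :
  re_alpha R j (\sum_l c 0 l *: tnth H l) = (c *m (rootmx H)^T) 0 j.
Proof.
rewrite linear_sum mxE; apply: eq_bigr => l _.
by rewrite linearZ /= !mxE.
Qed.

Lemma basis_expand (V : vectType k) (t : nat) (H : t.-tuple V) v :
  basis_of {: V} H -> v = \sum_l coord H l v *: tnth H l.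
Proof.
move=> bH; rewrite {1}(coord_basis bH (memvf v)).
by apply: eq_bigr => l _; rewrite -tnth_nth.
Qed.

Lemma rootmx_free (R : realization k n) (t : nat) (H : t.-tuple (re_h R)) :
  straight R -> basis_of {: re_h R} H -> row_free (rootmx H).
Proof.
move=> sR bH; apply: inj_row_free => c c0; apply/rowP => i; rewrite mxE.
apply: (free_enum sR (c := fun i => c 0 i)); apply/lfunP => T.
rewrite (basis_expand T bH) linear_sum [RHS]linear_sum; apply: eq_bigr => l _.
rewrite !linearZ /= zero_lfunE; congr (_ *: _).
have /rowP/(_ l) := c0; rewrite !mxE => <-; rewrite sum_lfunE.
by apply: eq_bigr => j _; rewrite !mxE scale_lfunE.
Qed.

(** The twisting vectors of a straight realization are only constrained by the
antisymmetry of alpha_j(v_i). *)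
Lemma twist_vec_prescribed (R : realization k n) (t : nat) (H : t.-tuple (re_h R))
    (v : 'I_n -> re_h R) :
  straight R -> basis_of {: re_h R} H ->
  (forall i j, re_alpha R j (v i) = - (re_alpha R i (v j) : k)) ->
  exists2 Theta : 'M[k]_t, Theta^T = - Theta &
    forall i, twist_vec H Theta i = v i.
Proof.
move=> sR bH va; pose M : 'M[k]_(n, t) := \matrix_(i, l) coord H l (v i).
have MA i j : (M *m (rootmx H)^T) i j = re_alpha R j (v i).
  rewrite {1}(basis_expand (v i) bH) linear_sum mxE; apply: eq_bigr => l _.
  by rewrite linearZ /= !mxE.
have [|Theta ThetaT e] := antisymmetric_factor (M := - M) (rootmx_free sR bH).
  apply/matrixP => i j; rewrite mulNmx !linearN /= opprK mxE [X in - X]mxE MA.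
  by rewrite [RHS]MA va opprK.
exists Theta => // i; rewrite [RHS](basis_expand _ bH) /twist_vec exchange_big.
apply: eq_bigr => l _; rewrite -scaler_suml; congr (_ *: _).
have /matrixP/(_ i l) := e; rewrite !mxE => e1.
rewrite -[RHS]opprK -e1 -sumrN; apply: eq_bigr => j _.
by have /matrixP/(_ j l) := ThetaT; rewrite !mxE => ->; rewrite mulrN.
Qed.

Lemma re_SE (R : realization k n) (P : 'M[k]_n) i j : realizes R P ->
  re_alpha R j (re_S R i) = (2^-1 *: (P + P^T)) i j.
Proof. by case=> hp hm _; rewrite /re_S linearZ linearD /= hp hm !mxE. Qed.

(** In coordinates, the S_i and the alpha_j are the two factors of a factorization of
the matrix (alpha_j(S_i)) through the Cartan subalgebra. *)
Lemma realization_unique (R R' : realization k n) :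
  straight R -> straight R' -> rank R = rank R' ->
  free [seq re_S R i | i <- enum 'I_n] -> free [seq re_S R' i | i <- enum 'I_n] ->
  (forall i j, re_alpha R j (re_S R i) = re_alpha R' j (re_S R' i)) ->
  exists (f : re_h R -> re_h R') f',
    [/\ linear f, cancel f f', cancel f' f,
        forall i, f (re_S R i) = re_S R' i &
        forall i T, re_alpha R' i (f T) = re_alpha R i T].
Proof.
move=> sR sR' rk fS fS' eS.
have [bH bH'] := (vbasisP {: re_h R}, vbasisP {: re_h R'}).
set H := vbasis _ in bH; set H' := vbasis _ in bH'.
pose s := \matrix_(i < n) rVof H (re_S R i).
pose s' := \matrix_(i < n) rVof H' (re_S R' i).
have free_s (Q : realization k n) (K : (rank Q).-tuple (re_h Q)) :
    basis_of {: re_h Q} K -> free [seq re_S Q i | i <- enum 'I_n] ->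
    row_free (\matrix_(i < n) rVof K (re_S Q i)).
  move=> bK fQ; apply: inj_row_free => c c0; apply/rowP => i; rewrite mxE.
  apply: (free_enum fQ (c := fun i => c 0 i)).
  apply: (can_inj (rVofK bK)); rewrite linear0 linear_sum -[RHS]c0 mulmx_sum_row.
  by apply: eq_bigr => j _; rewrite linearZ rowK.
have alphaE (Q : realization k n) (K : (rank Q).-tuple (re_h Q)) T j :
    basis_of {: re_h Q} K ->
    re_alpha Q j T = (rVof K T *m (rootmx K)^T) 0 j.
  move=> bK; rewrite -rootmxE {1}(basis_expand T bK).
  by congr (re_alpha _ _ _); apply: eq_bigr => l _; rewrite mxE.
have full_A (Q : realization k n) (K : (rank Q).-tuple (re_h Q)) :
    straight Q -> basis_of {: re_h Q} K -> row_full (rootmx K)^T.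
  by move=> sQ bK; rewrite /row_full mxrank_tr; apply: rootmx_free.
have e : s *m (rootmx H)^T = s' *m (rootmx H')^T.
  apply/row_matrixP => i; rewrite !row_mul !rowK; apply/rowP => j.
  by rewrite -!alphaE.
have [G [G' [GG' G'G sG GA]]] := factorization_unique rk
  (free_s R H bH fS) (free_s R' H' bH' fS') (full_A R H sR bH) (full_A R' H' sR' bH') e.
exists (fun T => vecof H' (rVof H T *m G)), (fun T => vecof H (rVof H' T *m G')).
split.
- by move=> c x y; rewrite linearP mulmxDl -scalemxAl linearP.
- by move=> T; rewrite (vecofK bH') -mulmxA GG' mulmx1 (rVofK bH).
- by move=> T; rewrite (vecofK bH) -mulmxA G'G mulmx1 (rVofK bH').
- move=> i; have /row_matrixP/(_ i) := sG; rewrite row_mul !rowK => ->.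
  exact: rVofK.
- move=> i T; rewrite (alphaE R' H') // (vecofK bH') -mulmxA GA.
  by rewrite -alphaE.
Qed.

End Realizations.

Lemma twist_realizes (k : fieldType) (n t : nat) (R : realization k n)
    (H : t.-tuple (re_h R)) (Theta : 'M[k]_t) (P : 'M[k]_n) :
  Theta^T = - Theta -> realizes R P ->
  realizes (twist_realization H Theta) (twist_mx H Theta P).
Proof.
move=> ThetaT [hp hm hS]; have tw i j :
    re_alpha R j (twist_vec H Theta i) = - (rootmx H *m Theta *m (rootmx H)^T) i j.
  rewrite /twist_vec exchange_big linear_sum mxE -sumrN; apply: eq_bigr => l _.
  rewrite -scaler_suml linearZ /= !mxE -mulNr; congr (_ * _).
  rewrite -sumrN; apply: eq_bigr => m _; rewrite mxE.
  by have /matrixP/(_ m l) := ThetaT; rewrite !mxE => ->; rewrite mulrN.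
have twT i j : (rootmx H *m Theta *m (rootmx H)^T) j i =
    - (rootmx H *m Theta *m (rootmx H)^T) i j.
  have <- : (rootmx H *m Theta *m (rootmx H)^T)^T i j =
    (rootmx H *m Theta *m (rootmx H)^T) j i by rewrite mxE.
  by rewrite !trmx_mul trmxK ThetaT mulNmx mulmxN mulmxA mxE.
rewrite /twist_mx; split=> [i j|i j|] /=.
- by rewrite linearD /= hp tw !mxE.
- by rewrite linearB /= hm tw -twT !mxE.
- rewrite (eq_map (g := re_S R)) // => i.
  by rewrite /re_S /= addrACA subrr addr0.
Qed.

(** Differences v_i of the coroots T_i^+ are twisting vectors because the
symmetric parts of P and P' agree; the coroots T_i^- then follow, the sums being
fixed by S_i. *)
Lemma prescribed_toral_twist (k : fieldType) (n t : nat) (R R' : realization k n)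
    (P P' : 'M[k]_n) (H : t.-tuple (re_h R)) (f : re_h R -> re_h R')
    (f' : re_h R' -> re_h R) :
  (2 : k) != 0 -> straight R -> basis_of {: re_h R} H ->
  realizes R P -> realizes R' P' -> P + P^T = P' + P'^T ->
  linear f -> cancel f' f ->
  (forall i T, re_alpha R' i (f T) = re_alpha R i T) ->
  (forall i, f (re_S R i) = re_S R' i) ->
  exists Theta : 'M[k]_t, [/\ Theta^T = - Theta,
    forall i, f (re_Tp R i + twist_vec H Theta i) = re_Tp R' i &
    forall i, f (re_Tm R i - twist_vec H Theta i) = re_Tm R' i].
Proof.
move=> two_neq0 sR bH [hp _ _] [hp' _ _] Psym lf f'K fa fS.
have af i T : re_alpha R i (f' T) = re_alpha R' i T by rewrite -fa f'K.
pose v i := f' (re_Tp R' i) - re_Tp R i.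
have [i j|Theta ThetaT tw] := twist_vec_prescribed (v := v) sR bH.
  rewrite /v !linearB /= !af !hp !hp'.
  have /matrixP/(_ i j) := Psym; rewrite !mxE => e.
  by apply/eqP; rewrite -addr_eq0 addrACA -e -opprD subrr.
have fTp i : f (re_Tp R i + twist_vec H Theta i) = re_Tp R' i.
  by rewrite tw /v addrC subrK f'K.
exists Theta; split=> // i.
have sumE (Q : realization k n) : re_Tp Q i + re_Tm Q i = 2 *: re_S Q i.
  by rewrite /re_S scalerA mulfV // scale1r.
apply: (addrI (f (re_Tp R i + twist_vec H Theta i))).
by rewrite -(linfD lf) addrACA subrr addr0 sumE fTp sumE (linfZ lf) fS.
Qed.

(** * Toral deformations with a given symmetric part *)

Theorem theorem3p3p4 (k : fieldType) (k_char0 : [pchar k] =i pred0) (n : nat)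
    (D : diagram n) (d : 'I_n -> rat) (Dd : symmetrizer D d)
    (P P' : 'M[k]_n) (hP : cartan_type D d P) (hP' : cartan_type D d P') :
  [/\ (forall (t : nat) (R : realization k n) (H : t.-tuple (re_h R)),
        realizes R P -> straight R -> rank R = t ->
        basis_of {: re_h R} H ->
        exists Theta : 'M[k]_t,
          [/\ Theta^T = - Theta,
              P' = twist_mx H Theta P,
              realizes (twist_realization H Theta) P',
              straight (twist_realization H Theta) &
              forall g : mplsba D d R,
              exists g' : mplsba D d (twist_realization H Theta),
                g' ≅ toral_deformation H Theta g]),
      (forall (t : nat) (R R' : realization k n) (H : t.-tuple (re_h R)),
        realizes R P -> straight R -> small R -> rank R = t ->
        realizes R' P' -> straight R' -> small R' -> rank R' = t ->
        basis_of {: re_h R} H ->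
        exists Theta : 'M[k]_t,
          Theta^T = - Theta /\
          forall (g : mplsba D d R) (g' : mplsba D d R'),
            g' ≅ toral_deformation H Theta g) &
      (forall (R : realization k n) (g : mplsba D d R),
        realizes R P -> straight R -> small R ->
        exists (R_A : realization k n) (y : mplsba D d R_A),
          [/\ realizes R_A (DAmx D k d), straight R_A, rank R_A = rank R &
              forall H : (rank R_A).-tuple (re_h R_A),
                basis_of {: re_h R_A} H ->
                exists Theta : 'M[k]_(rank R_A),
                  Theta^T = - Theta /\ g ≅ toral_deformation H Theta y])].
Proof.
have two_neq0 : (2 : k) != 0 by rewrite (pcharf0P k).1.
have Psym : P + P^T = P' + P'^T.
  by apply: (scalerI (invr_neq0 two_neq0)); rewrite [LHS]hP [RHS]hP'.
have PsymE i j : P i j + P j i = P' i j + P' j i.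
  by have /matrixP/(_ i j) := Psym; rewrite !mxE.
split.
- move=> t R H hR sR _ bH.
  have [|Theta ThetaT eP] := antisymmetric_congruence (L := P - P') (rootmx_free sR bH).
    apply/matrixP => i j; rewrite !mxE; apply/eqP.
    rewrite -addr_eq0 addrACA (addrC (P j i)) PsymE -opprD (addrC (P' j i)).
    by rewrite subrr.
  have ePt : P' = twist_mx H Theta P by rewrite /twist_mx eP subKr.
  have hRt := twist_realizes H ThetaT hR; rewrite -ePt in hRt.
  exists Theta; split=> // g.
  exact: (mplsba_toral_deformation (H := H) (R' := twist_realization H Theta) (f := id)
    (f' := id) two_neq0 ThetaT (fun _ _ _ => erefl) (fun=> erefl) (fun=> erefl)
    (fun _ _ => erefl) (fun=> erefl) (fun=> erefl) g).
- move=> t R R' H hR sR _ rkR hR' sR' _ rkR' bH.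
  have eS i j : re_alpha R j (re_S R i) = re_alpha R' j (re_S R' i).
    by rewrite (re_SE _ _ hR) (re_SE _ _ hR') Psym.
  have [[_ _ fS] [_ _ fS']] := (hR, hR').
  have [f [f' [lf fK f'K fSE fa]]] :=
    realization_unique sR sR' (etrans rkR (esym rkR')) fS fS' eS.
  have [Theta [ThetaT fTp fTm]] :=
    prescribed_toral_twist two_neq0 sR bH hR hR' Psym lf f'K fa fSE.
  exists Theta; split=> // g g'.
  exact: (mplsba_iso_toral_deformation two_neq0 ThetaT lf fK f'K fa fTp fTm).
- move=> R g hR sR _.
  pose R_A := Realization (re_S R) (re_S R) (re_alpha R).
  have re_S_A i : re_S R_A i = re_S R i.
    by rewrite /re_S /= -/(re_S R i) -mulr2n -scaler_nat scalerA mulVf // scale1r.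
  have DAT : (DAmx D k d)^T = DAmx D k d.
    by rewrite -hP linearZ linearD /= trmxK addrC.
  have hA : realizes R_A (DAmx D k d).
    split=> [i j|i j|] /=; first by rewrite (re_SE _ _ hR) hP.
      by rewrite (re_SE _ _ hR) hP -[in LHS]DAT mxE.
    by rewrite (eq_map re_S_A); case: hR.
  have PA : P + P^T = DAmx D k d + (DAmx D k d)^T.
    by rewrite DAT -hP -mulr2n -scaler_nat scalerA mulfV // scale1r.
  have [Theta0 [Theta0T fTp fTm]] := prescribed_toral_twist (R := R) (R' := R_A) (f := id)
    (f' := id) two_neq0 sR (vbasisP _) hR hA PA (fun=> (fun _ _ => erefl)) (fun=> erefl)
    (fun _ _ => erefl) (fun i => esym (re_S_A i)).
  have [y _] := mplsba_toral_deformation (R := R) (R' := R_A)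
    two_neq0 Theta0T (f := id) (f' := id)
    (fun _ _ _ => erefl) (fun=> erefl) (fun=> erefl) (fun _ _ => erefl) fTp fTm g.
  exists R_A, y; split=> // H bH.
  have [Theta [ThetaT gTp gTm]] := prescribed_toral_twist (R := R_A) (R' := R)
    (f := id) (f' := id) two_neq0 sR bH hA hR (esym PA) (fun _ _ _ => erefl)
    (fun=> erefl) (fun _ _ => erefl) re_S_A.
  exists Theta; split=> //.
  exact: (mplsba_iso_toral_deformation (R := R_A) (R' := R) (f := id) (f' := id) two_neq0 ThetaT
    (fun _ _ _ => erefl) (fun=> erefl) (fun=> erefl) (fun _ _ => erefl) gTp gTm).
Qed.
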